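(* Let $\Lambda$ and $\Lambda'$ be ordered continua and let $\vec{p}$ and $\vec{q}$ be sequences of integers greater than one. Then $S(\Lambda,\vec{p})$ and $S(\Lambda',\vec{q})$ have the same shape if and only if $\vec{p}$ and $\vec{q}$ are equivalent.
   Context: Equivalence of sequences: the characteristic of a sequence $\vec{p}=\langle p_1,p_2,\dots\rangle$ of integers greater than 1 is the family $h=h(\vec{p})$ indexed by the prime numbers, where $h_\pi\in\{0,1,2,\dots\}\cup\{\infty\}$ is the total number of times (possibly $\infty$) the prime $\pi$ appears in the factorizations of all the numbers $p_n$. Sequences $\vec{p}$ and $\vec{q}$ with characteristics $h=h(\vec{p})$ and $k=h(\vec{q})$ are equivalent if (1) $h_\pi=\infty$ if and only if $k_\pi=\infty$, and (2) $h_\pi\neq k_\pi$ for at most finitely many primes $\pi$. Shape: all spaces $X,Y$ are compact Hausdorff. Let $\mathcal{W}$ be the category whose objects are all spaces dominated (up to homotopy) by polyhedra and whose morphisms are homotopy classes of maps. For a space $X$, $\pi_X=[X,-]$ is the covariant functor from $\mathcal{W}$ to sets assigning to $W$ the set $[X,W]$ of homotopy classes of maps $X\to W$. A shape map from $X$ to $Y$ is a natural transformation $\Phi:\pi_Y\to\pi_X$; it is a shape equivalence if it is an invertible natural transformation (equivalently $\Phi:[Y,W]\to[X,W]$ is a bijection for every $W$ in $\mathcal{W}$). $X$ and $Y$ have the same shape if there is a shape equivalence from $X$ to $Y$. An ordered continuum is a nondegenerate compact connected space $\Lambda$ which has a linear order and whose topology is the order topology; $\partial\Lambda$ is the set consisting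 of its first and last points. For $n\ge 1$, $\Lambda^{(n)}=\Lambda_1\vee\dots\vee\Lambda_n$ denotes $n$ copies of $\Lambda$ laid end to end (the last point of $\Lambda_i$ is identified with the first point of $\Lambda_{i+1}$, orders preserved), and $\Sigma^{(n)}=\Lambda^{(n)}/\partial\Lambda^{(n)}$ is the ''circle'' obtained by identifying the first and last points of $\Lambda^{(n)}$; $\Sigma=\Sigma^{(1)}$. The identified endpoints of the copies of $\Lambda$ in $\Sigma^{(n)}$ are labeled in cyclic order $\infty_0,\dots,\infty_{n-1}$, and for $x\in\Lambda\setminus\partial\Lambda$, $\infty_i+x$ denotes the copy of $x$ in the $i$th copy of $\Lambda$ (the one starting at $\infty_i$). For positive integers $m,n$ the $m$-fold covering map $\phi^m_n:\Sigma^{(mn)}\to\Sigma^{(n)}$ is given by $\phi^m_n(\infty_i)=\infty_j$ and $\phi^m_n(\infty_i+x)=\infty_j+x$, where $j=i \bmod n$. For a sequence $\vec{p}=\langle p_1,p_2,\dots\rangle$ of positive integers, put $k(1)=1$ and $k(n)=p_1p_2\cdots p_{n-1}$ for $n>1$, and let $S(\Lambda,\vec{p})=\varprojlim\{\phi^{p_n}_{k(n)},\Sigma^{(k(n))},n\in\mathbb{N}\}$, the inverse limit with bonding maps $\phi^{p_n}_{k(n)}:\Sigma^{(k(n+1))}\to\Sigma^{(k(n))}$. *)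

(* Defs.v *)
From HB Require Import structures.
From mathcomp Require Import all_boot all_order all_algebra finmap generic_quotient.
From mathcomp Require Import all_classical all_reals all_analysis lra.

Set Implicit Arguments.
Unset Strict Implicit.
Unset Printing Implicit Defensive.

Import Order.TTheory GRing.Theory Num.Theory.
Import numFieldTopology.Exports numFieldNormedType.Exports.

Local Open Scope classical_set_scope.
Local Open Scope ring_scope.
Local Open Scope quotient_scope.

(* The sum lives in the extended reals, so infinite multiplicity is [+oo]. *)
Definition characteristic (R : realType) (p : nat -> nat) (l : nat) : \bar R :=
  (\sum_(0 <= n <oo) ((logn l (p n))%:R%:E))%E.

Definition equivalent_seq (R : realType) (p q : nat -> nat) : Prop :=
  (forall l, prime l ->
     characteristic R p l = +oo%E <-> characteristic R q l = +oo%E) /\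
  finite_set [set l | prime l /\ characteristic R p l <> characteristic R q l].

Lemma continuous_pair (Z X Y : topologicalType) (f : Z -> X) (g : Z -> Y) :
  continuous f -> continuous g -> continuous (fun z => (f z, g z)).
Proof. by move=> cf cg z; apply: cvg_pair; [exact: cf|exact: cg]. Qed.

Section homotopy.
Context (R : realType).

Definition homotopic (X Y : topologicalType) (f g : X -> Y) : Prop :=
  exists H : X * R -> Y,
    [/\ {within [set: X] `*` `[0, 1], continuous H},
        forall x, H (x, 0) = f x & forall x, H (x, 1) = g x].

Section equivalence.
Context (X Y : topologicalType).
Implicit Types f g h : X -> Y.

(* Homotopies may be taken to be continuous on all of [X * R]. *)
Lemma homotopicP f g : homotopic f g <->
  exists H : X * R -> Y,
    [/\ continuous H, forall x, H (x, 0) = f x & forall x, H (x, 1) = g x].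
Proof.
split=> [[H [cH H0 H1]]|[H [cH H0 H1]]]; last first.
  by exists H; split=> //; exact: continuous_subspaceT.
pose c (t : R) : R := (1 + `|t| - `|t - 1|) / 2.
have cc : continuous c.
  move=> t; apply: cvgM; last exact: cvg_cst.
  apply: cvgB; first by apply: cvgD; [exact: cvg_cst|exact: cvg_norm].
  by apply: cvg_norm; apply: cvgB; [exact: cvg_id|exact: cvg_cst].
have c01 (z : X * R) : (z.1, c z.2) \in [set: X] `*` `[0, 1].
  apply/mem_set; split=> //=; rewrite in_itv /= /c.
  by apply/andP; split; case: (ger0P z.2); case: (ger0P (z.2 - 1)); lra.
pose e (z : X * R) : [set: X] `*` `[0, 1] := exist _ (z.1, c z.2) (c01 z).
have ce : continuous e.
  apply/continuous_comp_initial/continuous_pair => z; first exact: cvg_fst.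
  by apply: (@continuous_comp _ _ _ snd c); [exact: cvg_snd|exact: cc].
move/subspace_sigL_continuousP : cH => cH.
exists (sigL _ H \o e); split.
- by move=> z; apply: continuous_comp; [exact: ce|exact: cH].
- by move=> x /=; rewrite /sigL /= set_valE /= /c normr0 sub0r normrN normr1 addr0 subrr mul0r.
- move=> x /=; rewrite /sigL /= set_valE /= /c subrr normr0 normr1 subr0.
  by rewrite (_ : (1 + 1) / 2 = 1 :> R) //; lra.
Qed.

Lemma homotopic_refl f : continuous f -> homotopic f f.
Proof.
move=> cf; apply/homotopicP; exists (f \o fst); split=> // x.
by apply: continuous_comp; [exact: cvg_fst|exact: cf].
Qed.

Lemma homotopic_sym f g : homotopic f g -> homotopic g f.
Proof.
move=> /homotopicP[H [cH H0 H1]]; apply/homotopicP.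
exists (fun z => H (z.1, 1 - z.2)); split=> [z|x|x] /=; last 2 first.
- by rewrite subr0.
- by rewrite subrr.
apply: (@continuous_comp _ _ _ (fun z : X * R => (z.1, 1 - z.2)) H); last exact: cH.
apply: continuous_pair => {}z; first exact: cvg_fst.
by apply: cvgB; [exact: cvg_cst|exact: cvg_snd].
Qed.

Lemma homotopic_trans g f h : homotopic f g -> homotopic g h -> homotopic f h.
Proof.
move=> /homotopicP[H [cH H0 H1]] /homotopicP[G [cG G0 G1]]; apply/homotopicP.
pose K (z : X * R) : Y :=
  if z.2 <= 1 / 2 then H (z.1, 2 * z.2) else G (z.1, 2 * z.2 - 1).
have csnd : continuous (fun z : X * R => 2 * z.2).
  by move=> z; apply: cvgM; [exact: cvg_cst|exact: cvg_snd].
have c1 : continuous (fun z : X * R => H (z.1, 2 * z.2)).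
  move=> z; apply: (@continuous_comp _ _ _ (fun z : X * R => (z.1, 2 * z.2)) H).
    by apply: continuous_pair => {}z; [exact: cvg_fst|exact: csnd].
  exact: cH.
have c2 : continuous (fun z : X * R => G (z.1, 2 * z.2 - 1)).
  move=> z.
  apply: (@continuous_comp _ _ _ (fun z : X * R => (z.1, 2 * z.2 - 1)) G).
    apply: continuous_pair => {}z; first exact: cvg_fst.
    by apply: cvgB; [exact: csnd|exact: cvg_cst].
  exact: cG.
pose A := (@snd X R) @^-1` [set t | t <= 1 / 2].
pose B := (@snd X R) @^-1` [set t | 1 / 2 <= t].
have clA : closed A.
  by apply: closed_comp; [move=> ? _; exact: cvg_snd|exact: closed_le].
have clB : closed B.
  by apply: closed_comp; [move=> ? _; exact: cvg_snd|exact: closed_ge].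
exists K; split.
- apply/continuous_subspace_setT.
  have -> : [set: X * R] = A `|` B.
    by apply/esym/seteqP; split=> // z _; rewrite /A/B/=; case: (leP z.2 (1 / 2));
      [left|move=> /ltW; right].
  apply: withinU_continuous => //.
    have eA : {in A, (fun z => H (z.1, 2 * z.2)) =1 K}.
      by move=> z /set_mem Az; rewrite /K ifT.
    exact: (subspace_eq_continuous eA) (continuous_subspaceT c1).
  have eB : {in B, (fun z => G (z.1, 2 * z.2 - 1)) =1 K}.
    move=> z /set_mem Bz; rewrite /K; case: ifPn => // Az.
    have -> : z.2 = 1 / 2 by apply/eqP; rewrite eq_le Az; exact: Bz.
    rewrite (_ : 2 * (1 / 2) = 1 :> R); last by lra.
    by rewrite H1 subrr G0.
  exact: (subspace_eq_continuous eB) (continuous_subspaceT c2).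
- by move=> x; rewrite /K /= mulr0 H0 ifT //; lra.
- move=> x; rewrite /K /= ifF; last by apply/negP; lra.
  by rewrite (_ : 2 * 1 - 1 = 1 :> R) ?G1 //; lra.
Qed.

End equivalence.

Lemma homotopic_comp (X Y Z : topologicalType) (f f' : X -> Y) (g g' : Y -> Z) :
  continuous f -> continuous g' ->
  homotopic f f' -> homotopic g g' -> homotopic (g \o f) (g' \o f').
Proof.
move=> cf cg' /homotopicP[H [cH H0 H1]] /homotopicP[G [cG G0 G1]].
apply: (@homotopic_trans _ _ (g' \o f)); apply/homotopicP.
  exists (fun z => G (f z.1, z.2)); split=> [|x|x] /=; [|exact: G0|exact: G1].
  move=> z; apply: (@continuous_comp _ _ _ (fun z : X * R => (f z.1, z.2)) G).
    apply: continuous_pair => {}z; last exact: cvg_snd.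
    by apply: (@continuous_comp _ _ _ fst f); [exact: cvg_fst|exact: cf].
  exact: cG.
exists (g' \o H); split=> [z|x|x] /=; rewrite ?H0 ?H1 //.
by apply: continuous_comp; [exact: cH|exact: cg'].
Qed.

Section classes.
Context (X Y : topologicalType).

Definition homotopic_rel : rel (continuousType X Y) :=
  fun f g => `[< homotopic f g >].

Lemma homotopic_rel_refl : reflexive homotopic_rel.
Proof. by move=> f; apply/asboolP/homotopic_refl; exact: cts_fun. Qed.

Lemma homotopic_rel_sym : symmetric homotopic_rel.
Proof. by move=> f g; apply/asbool_equiv_eq; split; exact: homotopic_sym. Qed.

Lemma homotopic_rel_trans : transitive homotopic_rel.
Proof.
by move=> g f h /asboolP fg /asboolP gh; apply/asboolP/(homotopic_trans fg gh).
Qed.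

Canonical homotopic_equiv := EquivRel homotopic_rel
  homotopic_rel_refl homotopic_rel_sym homotopic_rel_trans.

Definition hclass : Type := {eq_quot homotopic_equiv}.
HB.instance Definition _ := Quotient.on hclass.

Definition hclass_of (f : continuousType X Y) : hclass := \pi_hclass f.

Lemma hclass_ofP f g : hclass_of f = hclass_of g <-> homotopic f g.
Proof.
split; first by move=> /eqmodP/asboolP.
by move=> fg; apply/eqmodP/asboolP.
Qed.

Lemma hclass_of_repr (a : hclass) : hclass_of (repr a) = a.
Proof. exact: reprK. Qed.

End classes.

Definition hclass_comp (X Y Z : topologicalType)
    (b : hclass Y Z) (a : hclass X Y) : hclass X Z :=
  hclass_of (repr b \o repr a).

Lemma hclass_compE (X Y Z : topologicalType)
    (g : continuousType Y Z) (f : continuousType X Y) :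
  hclass_comp (hclass_of g) (hclass_of f) = hclass_of (g \o f).
Proof.
apply/hclass_ofP/homotopic_comp; [exact: cts_fun..| |];
  by apply/hclass_ofP; rewrite hclass_of_repr.
Qed.

Record simplicial_complex (V : choiceType) := SimplicialComplex {
  simplex : {fset V} -> Prop;
  simplex_neq0 : forall s, simplex s -> s != fset0;
  simplex_face : forall s t,
    simplex s -> t != fset0 -> (t `<=` s)%fset -> simplex t;
  simplex_vertex : forall v, simplex [fset v]%fset }.

Section realization.
Context (V : choiceType) (K : simplicial_complex V).

(* Barycentric coordinates of the points of the closed simplex on [s]. *)
Definition closed_simplex (s : {fset V}) : set (V -> R) :=
  [set x | [/\ forall v, 0 <= x v, forall v, v \notin s -> x v = 0 &
             \sum_(v <- s) x v = 1]].

Definition realization : Type :=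
  set_type [set x : V -> R | exists2 s, simplex K s & closed_simplex s x].
HB.instance Definition _ := Choice.on realization.

(* The weak (CW) topology: open means relatively open in every closed simplex,
   the latter with its Euclidean topology, i.e. that of pointwise convergence. *)
Definition realization_open (U : set realization) : Prop :=
  forall s, simplex K s ->
    exists2 C : set (prod_topology (fun _ : V => R)), open C &
      forall x : realization, closed_simplex s (val x) -> U x <-> C (val x).

Lemma realization_openT : realization_open setT.
Proof. by move=> s _; exists setT; first exact: openT. Qed.

Lemma realization_openI : setI_closed realization_open.
Proof.
move=> A B oA oB s Ks; have [C oC AC] := oA s Ks; have [D oD BD] := oB s Ks.
exists (C `&` D); first exact: openI.
by move=> x sx; split=> -[/(AC x sx) ? /(BD x sx)].
Qed.

Lemma realization_open_bigcup (I : Type) (F : I -> set realization) :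
  (forall i, realization_open (F i)) -> realization_open (\bigcup_i F i).
Proof.
move=> oF s Ks.
have /choice[C CP] : forall i, exists C : set (prod_topology (fun _ : V => R)),
    open C /\
    forall x : realization, closed_simplex s (val x) -> F i x <-> C (val x).
  by move=> i; have [C ? ?] := oF i s Ks; exists C.
exists (\bigcup_i C i); first by apply: bigcup_open => i _; case: (CP i).
move=> x sx; have FC i : F i x <-> C i (val x) by apply: (CP i).2.
by split=> -[i _ Fx]; exists i => //; apply/FC.
Qed.

HB.instance Definition _ := isOpenTopological.Build realization
  realization_openT realization_openI realization_open_bigcup.

End realization.

Definition dominated_by (W P : topologicalType) : Prop :=
  exists (f : continuousType W P) (g : continuousType P W),
    homotopic (g \o f) idfun.

(* The category W: objects are the spaces dominated by polyhedra, and the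
   morphisms from [W] to [W'] are the elements of [hclass W W']. *)
Record shape_obj := ShapeObj {
  shape_space :> topologicalType;
  shape_dominated : exists (V : choiceType) (K : simplicial_complex V),
    dominated_by shape_space (realization K) }.

(* Natural transformations from [[Y, -]] to [[X, -]]. *)
Record shape_map (X Y : topologicalType) := ShapeMap {
  shape_fun :> forall W : shape_obj, hclass Y W -> hclass X W;
  shape_natural : forall (W W' : shape_obj) (g : hclass W W') (a : hclass Y W),
    shape_fun (hclass_comp g a) = hclass_comp g (shape_fun a) }.

Definition shape_equivalence (X Y : topologicalType) (F : shape_map X Y) : Prop :=
  exists G : shape_map Y X,
    (forall W, cancel (F W) (G W)) /\ (forall W, cancel (G W) (F W)).

Definition same_shape (X Y : topologicalType) : Prop :=
  exists F : shape_map X Y, shape_equivalence F.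

End homotopy.

Definition ordered_continuum d (L : orderTopologicalType d) : Prop :=
  [/\ exists x y : L, x != y, compact [set: L] & connected [set: L]].

(* The space obtained from [T] by identifying [A] to a point. *)
Section collapse.
Context (T : topologicalType) (A : set T).

Definition collapse_rel : rel T := fun x y => (x == y) || `[< A x /\ A y >].

Lemma collapse_rel_refl : reflexive collapse_rel.
Proof. by move=> x; rewrite /collapse_rel eqxx. Qed.

Lemma collapse_rel_sym : symmetric collapse_rel.
Proof.
move=> x y; rewrite /collapse_rel eq_sym; congr (_ || _).
by apply/asbool_equiv_eq; split=> -[].
Qed.

Lemma collapse_rel_trans : transitive collapse_rel.
Proof.
move=> y x z /predU1P[->//|/asboolP[Ax Ay]] /predU1P[<-|/asboolP[_ Az]].
  by apply/orP; right; exact/asboolP.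
by apply/orP; right; exact/asboolP.
Qed.

Canonical collapse_equiv := EquivRel collapse_rel
  collapse_rel_refl collapse_rel_sym collapse_rel_trans.

Definition collapse : Type := {eq_quot collapse_equiv}.
HB.instance Definition _ := Quotient.on collapse.
HB.instance Definition _ := Topological.copy collapse (quotient_topology collapse).

End collapse.

Section circle.
Context (d : Order.disp_t) (L : orderTopologicalType d).

Definition first_point (x : L) : Prop := forall y : L, (x <= y)%O.
Definition last_point (x : L) : Prop := forall y : L, (y <= x)%O.

Section chain.
Context (n : nat).

(* [(i, None)] is the junction preceding the [i]th copy of [L]; [(i, Some x)]
   is the interior point [x] of the [i]th copy. *)
Definition chain_label (a : {i : 'I_n & L}) : nat * option L :=
  let: existT i x := a in
  if `[< last_point x >] then (i.+1, None)
  else if `[< first_point x >] then (val i, None)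
  else (val i, Some x).

Definition chain_rel : rel {i : 'I_n & L} :=
  fun a b => chain_label a == chain_label b.

Lemma chain_rel_refl : reflexive chain_rel.
Proof. by move=> a; exact: eqxx. Qed.

Lemma chain_rel_sym : symmetric chain_rel.
Proof. by move=> a b; exact: eq_sym. Qed.

Lemma chain_rel_trans : transitive chain_rel.
Proof. by move=> b a c /eqP ab /eqP bc; apply/eqP; rewrite ab. Qed.

Canonical chain_equiv :=
  EquivRel chain_rel chain_rel_refl chain_rel_sym chain_rel_trans.

(* [n] copies of [L] laid end to end. *)
Definition chain : Type := {eq_quot chain_equiv}.
HB.instance Definition _ := Quotient.on chain.
HB.instance Definition _ := Topological.copy chain (quotient_topology chain).

Definition chain_pt (i : 'I_n) (x : L) : chain :=
  \pi_chain (existT (fun=> L : Type) i x).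

Lemma chain_ptP (i j : 'I_n) (x y : L) : chain_pt i x = chain_pt j y <->
  chain_label (existT _ i x) = chain_label (existT _ j y).
Proof.
split; first by move=> /eqmodP/eqP.
by move=> ij; apply/eqmodP/eqP.
Qed.

Definition chain_boundary : set chain :=
  [set u | exists (i : 'I_n) (x : L), u = chain_pt i x /\
     ((i = 0%N :> nat /\ first_point x) \/ (i.+1 = n /\ last_point x))].

Definition circle : Type := collapse chain_boundary.
HB.instance Definition _ := Quotient.on circle.
HB.instance Definition _ := Topological.on circle.

Definition circle_pt (i : 'I_n) (x : L) : circle := \pi_circle (chain_pt i x).

Lemma circle_ptP (i j : 'I_n) (x y : L) : circle_pt i x = circle_pt j y <->
  chain_pt i x = chain_pt j y \/
  chain_boundary (chain_pt i x) /\ chain_boundary (chain_pt j y).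
Proof.
split; first by move=> /eqmodP/predU1P[|/asboolP]; [left|right].
by move=> ij; apply/eqmodP/orP; case: ij => ?; [left; exact/eqP|right; exact/asboolP].
Qed.

End chain.

Lemma modn_mul_ord (m n : nat) (i : 'I_(m * n)) : (i %% n < n)%N.
Proof. by rewrite ltn_mod; case: n i => // -[i]; rewrite muln0. Qed.

Definition ord_mod (m n : nat) (i : 'I_(m * n)) : 'I_n :=
  Ordinal (modn_mul_ord i).

(* The covering map, computed on a representative [(i, x)] of its argument. *)
Definition circle_cover (m n : nat) (u : circle (m * n)) : circle n :=
  let: existT i x := repr (repr u : chain (m * n)) in circle_pt (ord_mod i) x.

Lemma ord_mod_boundary (m n : nat) (i : 'I_(m * n)) (x : L) :
  (i = 0%N :> nat /\ first_point x) \/ (i.+1 = (m * n)%N /\ last_point x) ->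
  chain_boundary (chain_pt (ord_mod i) x).
Proof.
move=> ix; exists (ord_mod i), x; split=> //=.
case: ix => -[ei ex]; [left|right]; split=> //; first by rewrite ei mod0n.
apply/eqP; have : (i.+1 %% n == 0)%N by rewrite ei modnMl.
have n0 : (0 < n)%N by apply: leq_ltn_trans (modn_mul_ord i).
rewrite -addn1 -modnDml addn1; have := modn_mul_ord i.
by rewrite leq_eqVlt => /predU1P[->|lt]; rewrite ?eqxx // modn_small.
Qed.

Lemma circle_cover_chain (m n : nat) (i j : 'I_(m * n)) (x y : L) :
  chain_pt i x = chain_pt j y ->
  circle_pt (ord_mod i) x = circle_pt (ord_mod j) y.
Proof.
have junction (k l : 'I_(m * n)) (u v : L) : last_point u -> first_point v ->
    ~ last_point v -> l = k.+1 :> nat ->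
    circle_pt (ord_mod k) u = circle_pt (ord_mod l) v.
  move=> lu fv nlv lk; apply/circle_ptP; have := modn_mul_ord k.
  rewrite leq_eqVlt => /predU1P[kn|kn]; [right|left].
    split; [exists (ord_mod k), u|exists (ord_mod l), v]; split=> //=.
      by right.
    by left; rewrite lk -addn1 -modnDml addn1 kn modnn.
  apply/chain_ptP; rewrite /= (asboolT lu) (asboolF nlv) (asboolT fv).
  have -> : (l %% n = (k %% n).+1)%N; last by [].
  by rewrite lk -addn1 -modnDml addn1 modn_small.
move=> /chain_ptP /=.
case: (asboolP (last_point x)) => lx; case: (asboolP (last_point y)) => ly.
- by move=> [/val_inj ->]; congr circle_pt; apply/le_anti; rewrite lx ly.
- case: (asboolP (first_point y)) => fy //= -[ij].
  exact: (junction _ _ _ _ lx fy ly (esym ij)).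
- case: (asboolP (first_point x)) => fx //= -[ij].
  by symmetry; exact: (junction _ _ _ _ ly fx lx).
case: (asboolP (first_point x)) => fx; case: (asboolP (first_point y)) => fy //=.
- by move=> [/val_inj ->]; congr circle_pt; apply/le_anti; rewrite fx fy.
- by move=> [/val_inj -> ->].
Qed.

Lemma circle_coverE (m n : nat) (i : 'I_(m * n)) (x : L) :
  circle_cover (circle_pt i x) = circle_pt (ord_mod i) x.
Proof.
rewrite /circle_cover; set u := circle_pt i x.
case E : (repr (repr u : chain _)) => [j y].
have ji : circle_pt j y = u.
  by rewrite /circle_pt /chain_pt -E reprK [LHS]reprK.
have bd (k : 'I_(m * n)) (v : L) : chain_boundary (chain_pt k v) ->
    exists (l : 'I_(m * n)) (w : L),
      circle_pt (ord_mod k) v = circle_pt (ord_mod l) w /\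
      chain_boundary (chain_pt (ord_mod l) w).
  move=> [l [w [kl lw]]]; exists l, w; split; first exact: circle_cover_chain.
  exact: ord_mod_boundary.
have [/circle_cover_chain//|[/bd[k [v [-> kv]]] /bd[l [w [-> lw]]]]] := (circle_ptP _ _ _ _).1 ji.
by apply/circle_ptP; right.
Qed.

End circle.

Definition inverse_limit (X : nat -> topologicalType)
    (f : forall n, X n.+1 -> X n) : topologicalType :=
  set_type [set x : prod_topology X | forall n, f n (x n.+1) = x n].

(* Sequences are indexed from 0: [degree p n] is the product of the first [n]
   terms of [p]. *)
Fixpoint degree (p : nat -> nat) (n : nat) : nat :=
  if n is n'.+1 then (p n' * degree p n')%N else 1%N.

Definition solenoid d (L : orderTopologicalType d) (p : nat -> nat) :
    topologicalType :=
  inverse_limit (X := fun n => circle L (degree p n))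
    (fun n => @circle_cover d L (p n) (degree p n)).

(* Main.v *)
Require Import Defs.
From mathcomp Require Import all_boot all_order all_algebra finmap.
From mathcomp Require Import all_classical all_reals all_analysis lra ring.

Set Implicit Arguments.
Unset Strict Implicit.
Unset Printing Implicit Defensive.

Import Order.TTheory GRing.Theory Num.Theory.
Import numFieldTopology.Exports numFieldNormedType.Exports.

Local Open Scope classical_set_scope.
Local Open Scope ring_scope.

(** Why the theorem holds.  Let [C] be a circle and [K n] the product of the
first [n] terms of the sequence; the reason is that, whatever the ordered
continuum, a solenoid looks to every polyhedron like the inverse limit of circles
[C <- C <- ...] whose bonding maps are the power maps.  This is the record
[circle_expansion]: there are maps [th n] from the solenoid [X] to [C] with
[th n = (th m) ^ (K m / K n)] for [n <= m], every map [X -> W] is homotopic to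
some [g \o th n], and if [g0 \o th n] and [g1 \o th n] are homotopic then [g0] and
[g1] already become homotopic after composition with some power map
[K m / K n].  In other words [[X, W]] is the direct limit of copies of
[[C, W]], naturally in [W].

To obtain the expansion ([solenoid_expansion]), a monotone map [v] from the
continuum to [[0, 1]] wraps the [n]th circle of arcs around [C].  The resulting
maps [X -> C], indexed by the pairs [(n, v)], form a directed family that
separates the points of the compact space [X]; that is, [X] is the limit of a
directed system of genuine circles, even when the continuum is not metrizable.
Each map from [X] to a polyhedron is constant up to vertex stars on the fibers of
some member of the family ([fibers_in_stars]), hence factors through it up to
contiguity ([simplicial_approximation]).  Applied to [X * C], in which the second
factor carries the time parameter, the same argument treats homotopies.  For
fixed [n] all choices of [v] give homotopic maps.

The circle is the boundary of a triangle, so that it is itself a polyhedron.  Its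
universal covering is the map [wind] from the reals, and two maps from a compact
space to [C] are homotopic exactly when their difference lifts to the reals
([homotopic_shifted], [shifted_homotopic]).  Consequently every self-map of [C]
is homotopic to exactly one power map.

If the solenoids have the same shape, the bijection between [[Y, C]] and
[[X, C]] commutes with power maps.  As [[X, C]] is the set of fractions
[m / K n], comparing the image of the class of denominator 1 with the images of
its roots shows that the products of [q] divide a constant multiple of those of
[p], and conversely ([shape_map_divides]); this is equivalence of the sequences
([equivalent_of_dvd]).  Conversely, equivalent sequences have products that
become mutually cofinal for divisibility after multiplication by constants
([dvd_of_equivalent]), and then the two direct systems are interleaved, which
identifies the two limits naturally in [W] ([cofinal_same_shape]). *)

(** * Compactness and separation *)

Lemma continuous_comp_fun (S T U : topologicalType) (f : S -> T) (g : T -> U) :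
  continuous f -> continuous g -> continuous (g \o f).
Proof. by move=> cf cg x; apply: continuous_comp; [exact: cf|exact: cg]. Qed.

(** A continuous map from a compact set onto a Hausdorff space is a quotient map. The
representative [h] only has to agree with [g \o f] on the compact set, which
allows [f] to be a covering whose domain is not compact. *)
Lemma continuous_from_compact (S T U : topologicalType) (A : set S)
    (f : S -> T) (g : T -> U) (h : S -> U) :
  compact A -> hausdorff_space T -> continuous f ->
  (forall t, exists2 s, A s & f s = t) ->
  continuous h -> (forall s, A s -> g (f s) = h s) -> continuous g.
Proof.
move=> cA hT cf fsurj ch gfh; apply/continuous_closedP => B clB.
have -> : g @^-1` B = f @` (A `&` h @^-1` B).
  apply/seteqP; split=> [t Bgt|_ [s [As Bhs] <-]]; last by rewrite /= gfh.
  have [s As fs] := fsurj t; exists s => //; split=> //=.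
  by rewrite -gfh ?fs.
apply: compact_closed => //; apply: continuous_compact.
  exact: continuous_subspaceT.
by apply: compact_closedI => //; apply: closed_comp => // x _; exact: ch.
Qed.

(** Compactness in the form used throughout: a property that holds near each point for
some index, and is inherited by larger indices, holds everywhere for one index. *)
Lemma compact_directed (Z : topologicalType) (I : Type) (le : I -> I -> Prop)
    (P : I -> Z -> Prop) :
  compact [set: Z] -> inhabited I -> (forall i, le i i) ->
  (forall j i k, le i j -> le j k -> le i k) ->
  (forall i j, exists k, le i k /\ le j k) ->
  (forall i j z, le i j -> P i z -> P j z) ->
  (forall z : Z, exists i, nbhs z [set z' | P i z']) ->
  exists i, forall z, P i z.
Proof.
move=> /compact_near_coveringP cZ [i0] lexx le_trans le_dir Ple Pnear.
pose F : set_system I := filter_from [set: I] (fun i => [set j | le i j]).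
have FF : Filter F.
  apply: filter_from_filter; first by exists i0.
  move=> i j _ _; have [k [ik jk]] := le_dir i j; exists k => // l kl.
  by split; [exact: le_trans kl|exact: le_trans kl].
have [|i _ iP] := cZ I F P FF.
  move=> z _; have [i Pi] := Pnear z.
  exists ([set z' | P i z'], [set j | le i j]); first by split=> //; exists i.
  by move=> [z' j] [/= Piz' ij]; exact: Ple Piz'.
by exists i => z; exact: iP.
Qed.

Lemma prod_continuous (Z : topologicalType) (I : Type) (T : I -> topologicalType)
    (g : Z -> prod_topology T) :
  (forall i, continuous (fun z => g z i)) -> continuous g.
Proof.
move=> cg z; apply/cvg_sup => i.
exact: (@continuous_comp_initial _ _ _ (fun f : prod_topology T => f i) g (cg i) z).
Qed.

Lemma hausdorff_prod (T U : topologicalType) :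
  hausdorff_space T -> hausdorff_space U -> hausdorff_space (T * U)%type.
Proof.
move=> hT hU [a b] [c d] abcd; congr pair; [apply: hT|apply: hU] => A B nA nB.
  have [[x y] [/= Ax Bx]] := abcd (fst @^-1` A) (fst @^-1` B)
    (@cvg_fst _ _ (nbhs a) (nbhs b) _ _ nA) (@cvg_fst _ _ (nbhs c) (nbhs d) _ _ nB).
  by exists x.
have [[x y] [/= Ax Bx]] := abcd (snd @^-1` A) (snd @^-1` B)
  (@cvg_snd _ _ (nbhs a) (nbhs b) _ _ nA) (@cvg_snd _ _ (nbhs c) (nbhs d) _ _ nB).
by exists y.
Qed.

Lemma factor_through (X B U : topologicalType) (u : X -> B) (v : X -> U) :
  compact [set: X] -> hausdorff_space B -> continuous u ->
  (forall b, exists x, u x = b) -> continuous v ->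
  (forall x y, u x = u y -> v x = v y) ->
  exists2 T : B -> U, continuous T & forall x, T (u x) = v x.
Proof.
move=> cX hB cu /choice[s sK] cv uv; exists (v \o s) => [|x]; last exact: uv.
apply: (@continuous_from_compact X B U setT u _ v) => // [b|x _].
  by exists (s b).
exact: uv.
Qed.

Lemma compact_set_type (X : topologicalType) (A : set X) :
  compact A -> compact [set: set_type A].
Proof.
move=> cA F PF _; have [|x [Ax clx]] := cA (set_val @ F) _.
  by apply: (@filterE _ F) => a; exact: set_valP.
pose a : set_type A := exist _ x (mem_set Ax); exists a; split=> // B N FB.
rewrite nbhsE => -[_ [[W oW <-] Wa] WN].
have [y [[b Bb <-] Wb]] := clx (set_val @` B) W
  (@filterS _ F _ _ _ (@preimage_image _ _ set_val B) FB) (open_nbhs_nbhs (conj oW Wa)).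
by exists b; split=> //; exact: WN.
Qed.

Lemma closed_equalizer (Z Y : topologicalType) (f g : Z -> Y) :
  hausdorff_space Y -> continuous f -> continuous g -> closed [set z | f z = g z].
Proof.
move=> hY cf cg z clz; apply: hY => A B fA gB.
have [y [/= fgy [Ay By]]] := clz (f @^-1` A `&` g @^-1` B)
  (@filterI _ (nbhs z) _ _ _ (cf _ _ fA) (cg _ _ gB)).
by exists (f y); split=> //; rewrite fgy.
Qed.

Lemma separated_hausdorff (Z Y : topologicalType) (I : Type) (f : I -> Z -> Y) :
  hausdorff_space Y -> (forall i, continuous (f i)) ->
  (forall x y, (forall i, f i x = f i y) -> x = y) -> hausdorff_space Z.
Proof.
move=> hY cf fsep x y xy; apply: fsep => i; apply: hY => A B fA fB.
have [z [Az Bz]] := xy _ _ (cf i _ _ fA) (cf i _ _ fB).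
by exists (f i z).
Qed.

Lemma itv_convex (d : Order.disp_t) (T : porderType d) (i : interval T) (x y u : T) :
  x \in i -> y \in i -> (x <= u <= y)%O -> u \in i.
Proof.
case: i => [l r]; rewrite !itv_boundlr => /andP[lx _] /andP[_ yr] /andP[xu uy].
by apply/andP; split; [apply: le_trans lx _|apply: le_trans yr]; rewrite bnd_simp.
Qed.

(** * Maps into polyhedra *)

Section realization.
Context (R : realType) (V : choiceType) (K : simplicial_complex V).
Local Notation P := (realization R K).

Definition bary (x : P) : V -> R := val x.

Lemma bary_simplex (x : P) : exists2 s, simplex K s & closed_simplex s (bary x).
Proof. by have [s Ks sx] := set_mem (valP x); exists s. Qed.

Lemma bary_inj (x y : P) : bary x =1 bary y -> x = y.
Proof. by move=> xy; apply/val_inj/funext. Qed.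

Lemma bary_ge0 (x : P) v : 0 <= bary x v.
Proof. by have [s _ []] := bary_simplex x. Qed.

Lemma bary_neq0 (x : P) : exists v, bary x v != 0.
Proof.
have [s _ [_ _ s1]] := bary_simplex x; apply: contrapT => x0.
suff /eqP : \sum_(v <- s) bary x v = 0 by rewrite s1 oner_eq0.
apply: big1_seq => v _; apply: contrapT => /eqP xv; exact: x0 (ex_intro _ v xv).
Qed.

Lemma realization_openE : (open : set (set P)) = @realization_open R V K.
Proof. by []. Qed.

Lemma prod_eval_continuous (v : V) :
  continuous (fun x : prod_topology (fun _ : V => R) => x v).
Proof. exact: (@proj_continuous V (fun=> R) v). Qed.

Lemma bary_continuous (v : V) : continuous (bary ^~ v).
Proof.
apply/continuousP => A oA; rewrite realization_openE => s Ks.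
exists ((fun x : prod_topology (fun _ : V => R) => x v) @^-1` A) => //.
by move/continuousP: (@prod_eval_continuous v); exact.
Qed.

Lemma realization_hausdorff : hausdorff_space P.
Proof.
move=> x y xy; apply: bary_inj => v.
apply: (@Rhausdorff R) => A B Ax By.
have [z [Az Bz]] := xy _ _ (bary_continuous Ax) (bary_continuous By).
by exists (bary z v).
Qed.

Lemma closed_simplex_closed (s : {fset V}) :
  closed (closed_simplex s : set (prod_topology (fun _ : V => R))).
Proof.
have -> : (closed_simplex s : set (prod_topology (fun _ : V => R))) =
    \bigcap_v [set x | 0 <= x v] `&`
    \bigcap_(v in [set v | v \notin s]) [set x | x v = 0] `&`
    [set x | \sum_(v <- s) x v = 1].
  apply/seteqP; split=> [x [x0 xs x1]|x [[x0 xs] x1]].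
    by split; [split; [move=> v _; exact: x0|move=> v vs; exact: xs]|].
  by split; [move=> v; exact: x0|move=> v; exact: xs|exact: x1].
have cl (g : prod_topology (fun _ : V => R) -> R) (A : set R) :
    continuous g -> closed A -> closed (g @^-1` A).
  by move=> cg; apply: closed_comp => ? _; exact: cg.
apply: closedI; first apply: closedI.
- apply: closed_bigI => v _; apply: (cl (fun x => x v) [set y | 0 <= y]).
    exact: prod_eval_continuous.
  exact: closed_ge.
- apply: closed_bigI => v _; apply: (cl (fun x => x v) [set y | y = 0]).
    exact: prod_eval_continuous.
  exact: closed_eq.
- apply: (cl (fun x => \sum_(v <- s) x v) [set y | y = 1]); last exact: closed_eq.
  apply: (@continuous_big R V +%R 0 predT); first exact: add_continuous.
  by move=> v _; exact: prod_eval_continuous.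
Qed.

(** In the weak topology this needs the common finite support: near [z] only the
finitely many simplices spanned by [S] matter, and a closed simplex that misses
[g z] is avoided nearby. *)
Lemma realization_continuous (Z : topologicalType) (S : {fset V}) (g : Z -> P) :
  (forall z v, v \notin S -> bary (g z) v = 0) ->
  (forall v, continuous (fun z => bary (g z) v)) -> continuous g.
Proof.
move=> gS cg; apply/continuousP => U oU; rewrite openE => z Uz.
have cG : continuous (fun z => bary (g z) : prod_topology (fun _ : V => R)).
  exact: (@prod_continuous Z V (fun=> R)).
have nbhs_s (s : {fset V}) : \forall y \near z,
    simplex K s -> closed_simplex s (bary (g y)) -> U (g y).
  have [Ks|nKs] := pselect (simplex K s); last exact: nearW.
  rewrite realization_openE in oU; have [C oC UC] := oU s Ks.
  have [sz|nsz] := pselect (closed_simplex s (bary (g z))).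
    have Cz : C (bary (g z)) by apply/(UC (g z) sz).
    near=> y => _ sy; apply/(UC (g y) sy); near: y.
    exact/cG/open_nbhs_nbhs.
  have oN : open (~` (closed_simplex s : set (prod_topology (fun _ : V => R)))).
    exact/closed_openC/closed_simplex_closed.
  have : \forall y \near z, ~ closed_simplex s (bary (g y)).
    by apply: (cG z (~` (closed_simplex s))); exact: open_nbhs_nbhs.
  by apply: filterS => y nsy _ /nsy.
have : \forall y \near z, forall s, s \in fpowerset S ->
    simplex K s -> closed_simplex s (bary (g y)) -> U (g y).
  have := @filter_bigI _ _ (fpowerset S)
    (fun s => [set y | simplex K s -> closed_simplex s (bary (g y)) -> U (g y)])
    (nbhs z).
  move=> /(_ _ (fun s _ => nbhs_s s)); apply: filterS => y yI s sS; exact: (yI s sS).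
apply: filterS => y yS; have [s Ks sy] := bary_simplex (g y).
pose s' := (s `&` S)%fset.
have sub v : v \notin s' -> bary (g y) v = 0.
  rewrite /s' inE negb_and => /orP[|]; last exact: gS.
  by case: sy => _ + _ => /[apply].
have sum1 : \sum_(v <- s') bary (g y) v = 1.
  have [_ _ <-] := sy; apply: big_fset_incl; first exact: fsubsetIl.
  by move=> v _ /sub.
apply: (yS s'); first by rewrite fpowersetE fsubsetIr.
  apply: simplex_face Ks _ _; last exact: fsubsetIl.
  by apply: contraPneq sum1 => ->; rewrite big_seq_fset0 => /esym/eqP; rewrite oner_eq0.
by split=> // v; exact: bary_ge0.
Unshelve. all: by end_near. Qed.

(** A compact subset of a polyhedron meets finitely many open simplices. For each
vertex [v] that is used, fix a point [w v] where it is; the sets of points whose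
coordinates outside [S] stay below those of the chosen points are open, exhaust
the polyhedron as [S] grows, and exclude the image of [w v] unless [v] is in [S]. *)
Lemma compact_finite_support (Z : topologicalType) (f : Z -> P) :
  compact [set: Z] -> continuous f ->
  exists S : {fset V}, forall z v, v \notin S -> bary (f z) v = 0.
Proof.
move=> cZ cf; pose A := [set v | exists z, bary (f z) v != 0].
have [[z0]|Z0] := pselect (inhabited Z); last by exists fset0 => z; case: Z0.
have /choice[w wP] : forall v : V, exists z : Z, A v -> bary (f z) v != 0.
  by move=> v; have [[z ?]|nA] := pselect (A v); [exists z|exists z0].
pose Q (S : {fset V}) := [set x : P | forall v, A v -> v \notin S ->
  bary x v < bary (f (w v)) v].
have oQ S : open (Q S).
  rewrite realization_openE => s Ks.
  exists (\bigcap_(v in [set` s]) [set x : prod_topology (fun=> R) |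
      A v -> v \notin S -> x v < bary (f (w v)) v]).
    rewrite openE => x xs; apply: filter_bigI => v vs.
    have [Av|nAv] := pselect (A v); last first.
      by apply: (@filterE _ _ (nbhs_filter x)) => y /nAv.
    have [vS|vS] := boolP (v \in S).
      by apply: (@filterE _ _ (nbhs_filter x)) => y.
    have := @prod_eval_continuous v x [set r | r < bary (f (w v)) v] : _ -> nbhs x _.
    have : nbhs (x v) [set r | r < bary (f (w v)) v].
      by apply: open_nbhs_nbhs; split; [exact: open_lt|exact: xs].
    move=> lt1 /(_ lt1) lt2.
    by apply: (@filterS _ _ (nbhs_filter x) _ _ _ lt2) => y /= yw _ _.
  move=> x [x0 xs x1]; split=> [Qx v /= vs|xC v Av vS]; first exact: Qx.
  have [vs|vs] := boolP (v \in s); first exact: xC.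
  by rewrite /bary xs// lt_neqAle eq_sym wP// bary_ge0.
have := @compact_directed Z {fset V} (fun S T => (S `<=` T)%fset : Prop)
  (fun S z => Q S (f z)) cZ.
case.
- by split; exact: fset0.
- by move=> S; exact: fsubset_refl.
- by move=> T S W; exact: fsubset_trans.
- by move=> S T; exists (S `|` T)%fset; rewrite fsubsetUl fsubsetUr.
- move=> S T z ST QS v Av vT; apply: QS => //.
  by apply: contra vT; exact: (fsubsetP ST).
- move=> z; have [s Ks [_ sz _]] := bary_simplex (f z); exists s.
  apply: cf; apply: open_nbhs_nbhs; split=> // v Av vs.
  by rewrite sz// lt_neqAle eq_sym wP// bary_ge0.
move=> S QS; exists S => z v vS; apply/eqP; apply: contrapT => /negP zv.
have Av : A v by exists z.
by have := QS (w v) v Av vS; rewrite ltxx.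
Qed.

Definition interp (x y : P) (t : R) (v : V) : R :=
  (1 - t) * bary x v + t * bary y v.

Lemma simplex_sum (x : P) (s : {fset V}) :
  (forall v, v \notin s -> bary x v = 0) -> \sum_(v <- s) bary x v = 1.
Proof.
move=> xs; have [r Kr [_ xr xr1]] := bary_simplex x.
transitivity (\sum_(v <- (s `|` r)%fset) bary x v).
  by apply: big_fset_incl => [|v _]; [exact: fsubsetUl|exact: xs].
apply/esym; rewrite -[LHS]xr1.
by apply: big_fset_incl => [|v _]; [exact: fsubsetUr|exact: xr].
Qed.

Lemma interp_subproof (x y : P) (t : R) :
  (forall v, bary x v = 0 -> bary y v = 0) -> 0 <= t <= 1 ->
  exists2 s, simplex K s & closed_simplex s (interp x y t).
Proof.
move=> xy /andP[t0 t1]; have [s Ks [_ xs xs1]] := bary_simplex x.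
exists s => //; split=> [v|v vs|].
- by rewrite addr_ge0// mulr_ge0// ?bary_ge0// subr_ge0.
- by rewrite /interp xs// xy ?xs// !mulr0 addr0.
- rewrite big_split/= -!mulr_sumr xs1 simplex_sum; first by lra.
  by move=> v vs; rewrite xy// xs.
Qed.

(** The support of [g z] lies in that of [f z], so the segment from [f z] to [g z]
stays in a simplex. *)
Lemma contiguous_homotopic (Z : topologicalType) (f g : Z -> P) :
  compact [set: Z] -> continuous f -> continuous g ->
  (forall z v, bary (f z) v = 0 -> bary (g z) v = 0) -> homotopic R f g.
Proof.
move=> cZ cf cg fg; have [S fS] := compact_finite_support cZ cf.
(* Clamping the time parameter keeps the interpolation in the simplex. *)
pose c (t : R) : R := Num.max 0 (Num.min 1 t).
have c01 t : 0 <= c t <= 1 by rewrite /c le_max lexx ge_max ler01 ge_min lexx.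
have cc : continuous c.
  move=> t; apply: continuous_max; first exact: cvg_cst.
  by apply: continuous_min; [exact: cvg_cst|exact: cvg_id].
pose H (z : Z * R) : P := exist _ (interp (f z.1) (g z.1) (c z.2))
  (mem_set (interp_subproof (fg z.1) (c01 z.2))).
apply/homotopicP; exists H; split=> [|x|x].
- apply: (@realization_continuous _ S) => [[z t] v vS|v] /=.
    by rewrite /bary/= /interp fg fS// !mulr0 addr0.
  have fst_cont : continuous (@fst Z R) by move=> ?; exact: cvg_fst.
  have snd_cont : continuous (@snd Z R) by move=> ?; exact: cvg_snd.
  have cfv := continuous_comp_fun fst_cont (continuous_comp_fun cf (@bary_continuous v)).
  have cgv := continuous_comp_fun fst_cont (continuous_comp_fun cg (@bary_continuous v)).
  have cct := continuous_comp_fun snd_cont cc.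
  move=> z; apply: cvgD; apply: cvgM.
  + by apply: cvgB; [exact: cvg_cst|exact: cct].
  + exact: cfv.
  + exact: cct.
  + exact: cgv.
- apply: bary_inj => v; rewrite /bary /= /interp /c.
  by rewrite (min_r ler01) maxxx subr0 mul1r mul0r addr0.
- apply: bary_inj => v; rewrite /bary /= /interp /c.
  by rewrite minxx (max_r ler01) subrr mul1r mul0r add0r.
Qed.

(** The nerve construction. Let [w b] be a vertex whose open star contains the image
of the fiber over [b]; the map [h] is the map of a fine cover of [B] into its
nerve, given by a partition of unity, followed by the vertex map [w]. A weight
that is positive at [q z] belongs to a [b] such that [w b] is in the support of
[f z]. *)
Lemma simplicial_approximation (Z B : topologicalType) (q : Z -> B) (f : Z -> P) :
  compact [set: Z] -> compact [set: B] -> hausdorff_space B ->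
  continuous q -> (forall b, exists z, q z = b) -> continuous f ->
  (forall b, exists v, forall z, q z = b -> bary (f z) v != 0) ->
  exists2 h : B -> P, continuous h &
    forall z v, bary (f z) v = 0 -> bary (h (q z)) v = 0.
Proof.
move=> cZ cB hB cq qsurj cf /choice[w wP].
have clC v : closed (q @` [set z | bary (f z) v = 0]).
  apply: compact_closed => //; apply: continuous_compact.
    exact: continuous_subspaceT.
  rewrite -[X in compact X]setTI; apply: compact_closedI => //.
  apply: (@closed_comp _ _ (fun z => bary (f z) v) [set r | r = 0]) => [z _|].
    exact: (continuous_comp_fun cf (@bary_continuous v)).
  exact: closed_eq.
have /choice[om omP] : forall b : B, exists om : B -> R,
    [/\ continuous om, forall c, 0 <= om c, om b != 0 &
      forall z, bary (f z) (w b) = 0 -> om (q z) = 0].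
  move=> b; have cl1 : closed [set b].
    exact/accessible_closed_set1/hausdorff_accessible.
  have dis : q @` [set z | bary (f z) (w b) = 0] `&` [set b] = set0.
    apply/seteqP; split=> // c [[z /= fz0 qzc] /= cb].
    by have := wP b z; rewrite qzc cb fz0 eqxx => /(_ erefl).
  have /(@uniform_separatorP _ R)[om [com om01 om0 om1]] :=
    (@normal_separatorP R B).1 (compact_normal hB cB) _ _ (clC (w b)) cl1 dis.
  exists om; split=> //.
  - by move=> c; have := om01 (om c) (ex_intro2 _ _ c I erefl); rewrite /= in_itv/= => /andP[].
  - by rewrite (om1 (om b))// ?oner_eq0//; exists b.
  - by move=> z fz; rewrite (om0 (om (q z)))//; exists (q z) => //; exists z.
have com b : continuous (om b) by case: (omP b).
have om0 b c : 0 <= om b c by case: (omP b).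
have [D tot_gt0] : exists D : {fset B}, forall b, 0 < \sum_(c <- D) om c b.
  apply: (compact_directed (le := fun S T : {fset B} => (S `<=` T)%fset)
    (P := fun D b => 0 < \sum_(c <- D) om c b) cB).
  - by split; exact: fset0.
  - by move=> S; exact: fsubset_refl.
  - by move=> T S W; exact: fsubset_trans.
  - by move=> S T; exists (S `|` T)%fset; rewrite fsubsetUl fsubsetUr.
  - move=> S T b ST /lt_le_trans; apply.
    rewrite (big_fsetID _ (mem S) T) /=.
    have -> : [fset x | x in T & x \in S]%fset = S.
      by apply/fsetP => x; rewrite !inE /= andbC; case: (boolP (x \in S)) => //= /(fsubsetP ST).
    by rewrite lerDl sumr_ge0.
  - move=> b; exists [fset b]%fset.
    have : nbhs b (om b @^-1` [set r | 0 < r]).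
      apply: com; apply: open_nbhs_nbhs; split; first exact: open_gt.
      by rewrite /= lt_neqAle om0 andbT eq_sym; case: (omP b).
    by apply: filterS => c /=; rewrite big_seq_fset1.
pose tot b := \sum_(c <- D) om c b.
have tot_neq0 b : tot b != 0 by rewrite gt_eqF// tot_gt0.
pose hv b v := (\sum_(c <- D) if w c == v then om c b else 0) / tot b.
have hv0 z v : bary (f z) v = 0 -> hv (q z) v = 0.
  move=> fzv; rewrite /hv big1 ?mul0r// => c _; case: eqP => // wc.
  by case: (omP c) => _ _ _; apply; rewrite wc.
have hP b : exists2 s, simplex K s & closed_simplex s (hv b).
  have [z <-] := qsurj b; have [s Ks [_ sz _]] := bary_simplex (f z).
  exists s => //; split=> [v|v vs|].
  - by rewrite divr_ge0 ?sumr_ge0// => c _; case: ifP.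
  - by rewrite hv0// sz.
  - rewrite -mulr_suml exchange_big/= -[RHS](divff (tot_neq0 (q z))); congr (_ / _).
    apply: eq_bigr => c _; have [ws|ws] := boolP (w c \in s).
      rewrite (bigD1_seq (w c)) ?fset_uniq //= eqxx big1 ?addr0// => v.
      by rewrite eq_sym => /negPf ->.
    have [_ _ _ ->] := omP c; last exact: sz.
    by apply: big1 => v _; case: ifP.
pose h b : P := exist _ (hv b) (mem_set (hP b)).
exists h; last by move=> z v; exact: hv0.
apply: (@realization_continuous _ [fset w c | c in D]%fset) => [b v vD|v].
  rewrite /bary/= /hv big_seq big1 ?mul0r// => c cD; case: eqP => // wc.
  by move: vD; rewrite -wc in_imfset.
have csum (F : B -> B -> R) : (forall c, continuous (F c)) ->
    continuous (fun b => \sum_(c <- D) F c b).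
  by move=> cF; apply: (@continuous_big R B +%R 0 predT); [exact: add_continuous|].
have c1 := csum _ com.
have c2 : continuous (fun b => \sum_(c <- D) if w c == v then om c b else 0).
  by apply: csum => c; case: eqP => _ // b; exact: cvg_cst.
by move=> b; apply: cvgM; [exact: c2|apply: cvgV; [exact: tot_neq0|exact: c1]].
Qed.

End realization.

(** * Directed families of maps and vertex stars *)

Section directed_family.
Context (R : realType) (V : choiceType) (K : simplicial_complex V).
Local Notation P := (realization R K).
Context (Z B : topologicalType) (I : Type) (le : I -> I -> Prop) (q : I -> Z -> B).
Hypotheses (cZ : compact [set: Z]) (hB : hausdorff_space B).
Hypothesis cq : forall i, continuous (q i).
Hypothesis le_refl : forall i, le i i.
Hypothesis le_trans : forall j i k, le i j -> le j k -> le i k.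
Hypothesis le_dir : forall i j, exists k, le i k /\ le j k.
Hypothesis q_le : forall i j, le i j -> forall x y, q j x = q j y -> q i x = q i y.
Hypothesis q_sep : forall x y, (forall i, q i x = q i y) -> x = y.

(** A point and a closed set have disjoint images under one member of the family. *)
Lemma separated_from_closed (i0 : I) (C : set Z) (x : Z) : closed C -> ~ C x ->
  exists i, forall y, C y -> q i y <> q i x.
Proof.
move=> clC nCx.
have [||i iP] := @compact_directed Z I le (fun i y => C y -> q i y <> q i x) cZ
  (inhabits i0) le_refl le_trans le_dir.
- by move=> i j y ij iP /iP nq /(q_le ij).
- move=> y; have [Cy|nCy] := pselect (C y); last first.
    exists i0; have : nbhs y (~` C).
      by apply: open_nbhs_nbhs; split => //; exact: closed_openC.
    by apply: filterS => z nCz /nCz.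
  have [i iP] : exists i, q i y <> q i x.
    apply: contrapT => nq; apply: nCx; suff -> : x = y by [].
    by apply: q_sep => i; apply: contrapT => /nesym qi; apply: nq; exists i.
  exists i; have : nbhs y (~` (q i @^-1` [set q i x])).
    apply: open_nbhs_nbhs; split => //; apply: closed_openC.
    apply: closed_comp => [? _|]; first exact: cq.
    exact/accessible_closed_set1/hausdorff_accessible.
  by apply: filterS => z /= qz _.
- by exists i.
Qed.

(** The fibers of the family shrink to points and open stars are open, so near each
point the fibers of a late member fit into a star; compactness makes the member
uniform. The image of the complement of a star is closed because [B] is
Hausdorff, hence the claim is inherited by neighboring fibers. *)
Lemma fibers_in_stars (i0 : I) (f : Z -> P) : continuous f ->
  exists2 i, le i0 i &
    forall x, exists v, forall y, q i y = q i x -> bary (f y) v != 0.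
Proof.
move=> cf; have [|||i iP] := @compact_directed Z {i | le i0 i}
  (fun i j => le (sval i) (sval j))
  (fun i x => exists v, forall y, q (sval i) y = q (sval i) x -> bary (f y) v != 0)
  cZ (inhabits (exist _ i0 (le_refl i0))) (fun i => le_refl (sval i))
  (fun j i k => @le_trans (sval j) (sval i) (sval k)).
- move=> [i ii] [j ij]; have [k [ik jk]] := le_dir i j.
  by exists (exist _ k (le_trans ii ik)).
- by move=> i j x ij [v vP]; exists v => y /(q_le ij)/vP.
- move=> x; have [v xv] := bary_neq0 (f x).
  pose C := [set y | bary (f y) v = 0].
  have clC : closed C.
    apply: (@closed_comp _ _ (fun z => bary (f z) v) [set r | r = 0]) => [z _|].
      exact: (continuous_comp_fun cf (@bary_continuous _ _ K v)).
    exact: closed_eq.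
  have [i iP] := separated_from_closed i0 clC (elimN eqP xv).
  have [k [ik kk]] := le_dir i i0; exists (exist _ k kk).
  have : nbhs x (q k @^-1` (~` (q k @` C))).
    apply: cq; apply: open_nbhs_nbhs; split; last first.
      by move=> [y Cy qy]; apply: (iP y Cy); exact: q_le qy.
    have cC : compact C by rewrite -[C]setTI; exact: compact_closedI.
    apply/closed_openC/(compact_closed hB)/continuous_compact => //.
    exact/continuous_subspaceT/cq.
  apply: filterS => z nz; exists v => y qy; apply/eqP => fy; apply: nz.
  by exists y.
- by case: i iP => i i0i iP; exists i.
Qed.

End directed_family.

(** * The circle as the boundary of a triangle *)

Section triangle.
Context (R : realType).

Definition idist (t : R) : R := `|t - (Num.floor (t + 1 / 2))%:~R|.

Lemma idist_int (t : R) : exists m : int, idist t = `|t - m%:~R|.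
Proof. by eexists. Qed.

Lemma idist_half (t : R) : idist t <= 1 / 2.
Proof.
have := floor_itv (t + 1 / 2); rewrite /idist intrD => /andP[].
set m := (Num.floor _)%:~R; rewrite ler_norml; lra.
Qed.

Lemma intr_norm_ge1 (n : int) : n != 0 -> 1 <= `|n%:~R : R|.
Proof.
by move=> n0; rewrite -intr_norm -[1]/(1%:~R) ler_int -gtz0_ge1 normr_gt0.
Qed.

Lemma idist_le (t : R) (m : int) : idist t <= `|t - m%:~R|.
Proof.
have [n tn] := idist_int t; have [->|nm] := eqVneq m n; first by rewrite tn.
have := @intr_norm_ge1 (n - m); rewrite subr_eq0 eq_sym nm intrB => /(_ isT).
have := idist_half t; rewrite tn => t2 nm1.
have := ler_distD t n%:~R m%:~R : _ <= `|_ - t| + `|t - m%:~R|; rewrite (distrC n%:~R t); lra.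
Qed.

Lemma idistDz (t : R) (m : int) : idist (t + m%:~R) = idist t.
Proof.
apply/le_anti/andP; split.
  have [n ->] := idist_int t; apply: le_trans (idist_le _ (n + m)) _.
  by rewrite intrD opprD addrACA subrr addr0.
have [n ->] := idist_int (t + m%:~R); apply: le_trans (idist_le _ (n - m)) _.
by rewrite intrB opprB addrA.
Qed.

Lemma idist_small (t : R) : `|t| <= 1 / 2 -> idist t = `|t|.
Proof.
move=> t2; apply/le_anti/andP; split.
  by have := idist_le t 0; rewrite subr0.
have [n ->] := idist_int t; have [->|n0] := eqVneq n 0; first by rewrite subr0.
by have := intr_norm_ge1 n0; have := ler_distD t 0 n%:~R; rewrite !sub0r !normrN; lra.
Qed.

Lemma idist_continuous : continuous idist.
Proof.
have lip (t s : R) : idist t - idist s <= `|s - t|.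
  have [n ->] := idist_int s; rewrite lerBlDr; apply: le_trans (idist_le t n) _.
  by rewrite (distrC s t) ler_distD.
move=> t; apply/cvgrPdist_le => e e0; near=> s.
have := lip t s; have := lip s t; rewrite (distrC s t) ler_norml => ? ?.
have ts : `|t - s| <= e by near: s; apply: cvgr_dist_le.
by apply/andP; split; lra.
Unshelve. all: by end_near. Qed.

(** The barycentric coordinates of the covering map of the triangle are translates
of this function, which has period 1, height 1 and support of radius 1/3. *)
Definition bump (t : R) : R := Num.max 0 (1 - 3 * idist t).

Lemma bump_continuous : continuous bump.
Proof.
move=> t; apply: (@continuous_max R _ (fun=> 0) (fun t => 1 - 3 * idist t)); first exact: cvg_cst.
apply: cvgB; first exact: cvg_cst.
by apply: cvgM; [exact: cvg_cst|exact: idist_continuous].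
Qed.

Lemma bumpDz (t : R) (m : int) : bump (t + m%:~R) = bump t.
Proof. by rewrite /bump idistDz. Qed.

Lemma bump_right (r : R) : 0 <= r <= 1 -> bump (r / 3) = 1 - r.
Proof.
move=> /andP[r0 r1]; rewrite /bump idist_small ger0_norm; try lra.
by rewrite mulrC divfK ?max_r//; lra.
Qed.

Lemma bump_left (r : R) : 0 <= r <= 1 -> bump ((r - 1) / 3) = r.
Proof.
move=> /andP[r0 r1]; rewrite /bump idist_small ler0_norm; try lra.
by rewrite max_r; lra.
Qed.

Lemma bump_far (r : R) : 0 <= r <= 1 -> bump ((r + 1) / 3) = 0.
Proof.
move=> /andP[r0 r1]; rewrite /bump max_l//.
have [n ->] := idist_int ((r + 1) / 3).
have [n0|n1] := leP n 0.
  have : (n%:~R : R) <= 0 by rewrite (ler_int _ n 0).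
  move=> ?; rewrite ger0_norm; lra.
have : (1 : R) <= n%:~R by rewrite -[1]/(1%:~R) ler_int.
move=> ?; rewrite ler0_norm; lra.
Qed.

Program Definition triangle : simplicial_complex 'I_3 :=
  @SimplicialComplex 'I_3 (fun s => s != fset0 /\ (#|` s| <= 2)%N) _ _ _.
Next Obligation. by move=> s []. Qed.
Next Obligation.
move=> s t [_ s2] t0 ts; split=> //; exact: leq_trans (fsubset_leq_card ts) s2.
Qed.
Next Obligation.
by move=> v /=; rewrite cardfs1; split=> //; apply/fset0Pn; exists v; rewrite inE eqxx.
Qed.

Definition circ : topologicalType := realization R triangle.

Lemma triangle_simplexP (x : 'I_3 -> R) :
  (forall i, 0 <= x i) -> \sum_i x i = 1 -> (exists k, x k = 0) ->
  exists2 s, simplex triangle s & closed_simplex s x.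
Proof.
move=> x0 x1 [k xk]; pose s := [fset i in enum 'I_3 | i != k]%fset.
have sE i : (i \in s) = (i != k) by rewrite !inE /= mem_enum.
have s2 : #|` s| = 2.
  have /card_uniqP <- := fset_uniq s.
  by rewrite (eq_card (B := predC1 k)) ?cardC1 ?card_ord.
exists s.
  by split; [rewrite -cardfs_gt0 s2|rewrite s2].
split=> // [v|]; first by rewrite sE negbK => /eqP ->.
rewrite big_uniq ?fset_uniq//= -x1 [RHS](bigD1 k)//= xk add0r.
by apply: eq_bigl => i; exact: sE.
Qed.

Definition wind_coord (t : R) (i : 'I_3) : R := bump (t - (i : nat)%:R / 3).

Lemma wind_coordDz (t : R) (m : int) i : wind_coord (t + m%:~R) i = wind_coord t i.
Proof. by rewrite /wind_coord addrAC bumpDz. Qed.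

Lemma wind_coordE (j : nat) (r : R) (i : 'I_3) : (j < 3)%N -> 0 <= r <= 1 ->
  wind_coord ((j%:R + r) / 3) i =
    if i == j :> nat then 1 - r else if i == (j.+1 %% 3)%N :> nat then r else 0.
Proof.
move=> j3 r01; rewrite /wind_coord -mulrBl addrAC.
case: i => -[|[|[|//]]] ?; case: j j3 => [|[|[|//]]] _ /=.
- by rewrite subrr add0r bump_right.
- by rewrite subr0 addrC bump_far.
- rewrite (_ : (2 - 0 + r) / 3 = (r - 1) / 3 + 1%:~R); last by lra.
  by rewrite bumpDz bump_left.
- by rewrite sub0r addrC bump_left.
- by rewrite subrr add0r bump_right.
- rewrite (_ : (2 - 1 + r) / 3 = (r + 1) / 3); last by lra.
  by rewrite bump_far.
- rewrite (_ : (0 - 2 + r) / 3 = (r + 1) / 3 + (-1)%:~R); last by lra.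
  by rewrite bumpDz bump_far.
- rewrite (_ : (1 - 2 + r) / 3 = (r - 1) / 3); last by lra.
  by rewrite bump_left.
- by rewrite subrr add0r bump_right.
Qed.

(** Modulo the integers, [t] lies on the edge of the triangle from vertex [j] to the
next one, at barycentric parameter [r]. *)
Lemma third_decomp (t : R) : exists (m : int) (j : nat) (r : R),
  [/\ (j < 3)%N, 0 <= r < 1 & t = (j%:R + r) / 3 + m%:~R].
Proof.
have := floor_itv (3 * t); set n := Num.floor _.
move=> /andP[n0 n1]; have := divz_eq n 3; have := ltz_pmod n (isT : (0 < 3 :> int)).
have := @modz_ge0 n 3 isT; case: (n %% 3)%Z => // j _ j3 nE.
exists (n %/ 3)%Z, j, (3 * t - n%:~R); split=> //.
  by rewrite intrD in n1; lra.
rewrite {1}nE intrD intrM -pmulrn; lra.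
Qed.

Lemma wind_subproof (t : R) :
  exists2 s, simplex triangle s & closed_simplex s (wind_coord t).
Proof.
apply: triangle_simplexP => [i||].
- by rewrite /wind_coord /bump le_max lexx.
- have [m [j [r [j3 /andP[r0 r1] ->]]]] := third_decomp t.
  have r01 : 0 <= r <= 1 by rewrite r0 ltW.
  rewrite !big_ord_recr big_ord0 /= !wind_coordDz !wind_coordE//=.
  by case: j j3 => [|[|[|//]]] _ /=; lra.
- have [m [j [r [j3 /andP[r0 r1] ->]]]] := third_decomp t.
  have r01 : 0 <= r <= 1 by rewrite r0 ltW.
  have k3 : (j.+2 %% 3 < 3)%N by rewrite ltn_mod.
  exists (Ordinal k3); rewrite wind_coordDz wind_coordE//=.
  by case: j j3 {k3} => [|[|[|//]]] _.
Qed.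

(** The universal covering of the circle, with the integers as group of periods. *)
Definition wind (t : R) : circ := exist _ (wind_coord t) (mem_set (wind_subproof t)).

Lemma windE t i : bary (wind t) i = wind_coord t i. Proof. by []. Qed.

Lemma wind_continuous : continuous wind.
Proof.
apply: (@realization_continuous _ _ _ _ [fset i in enum 'I_3]%fset) => [t i|i].
  by rewrite !inE mem_enum.
apply: (@continuous_comp_fun _ _ _ (fun t : R => t - (i : nat)%:R / 3) bump).
  by move=> t; apply: cvgB; [exact: cvg_id|exact: cvg_cst].
exact: bump_continuous.
Qed.

Lemma windDz (t : R) (m : int) : wind (t + m%:~R) = wind t.
Proof. by apply: bary_inj => i; rewrite !windE wind_coordDz. Qed.

Lemma wind_inj (s t : R) : wind s = wind t -> exists m : int, s = t + m%:~R.
Proof.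
have [m [j [r [j3 r01 ->]]]] := third_decomp s.
have [n [k [u [k3 u01 ->]]]] := third_decomp t.
rewrite !windDz => st.
have H (i : 'I_3) : (if i == j :> nat then 1 - r else if i == (j.+1 %% 3)%N :> nat then r else 0)
    = (if i == k :> nat then 1 - u else if i == (k.+1 %% 3)%N :> nat then u else 0).
  move: r01 u01 => /andP[r0 r1] /andP[u0 u1].
  by rewrite -!wind_coordE ?r0 ?u0 ?ltW// -!windE st.
suff [-> ->] : j = k /\ r = u by exists (m - n); rewrite intrB; lra.
have := H (@Ordinal 3 0 isT); have := H (@Ordinal 3 1 isT); have := H (@Ordinal 3 2 isT).
move: r01 u01 => /andP[? ?] /andP[? ?].
by case: j j3 {H st} => [|[|[|//]]] _; case: k k3 => [|[|[|//]]] _ //= *;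
  first [by exfalso; lra|by split=> //; lra].
Qed.

Lemma wind_surj (x : circ) : exists2 t, 0 <= t <= 1 & wind t = x.
Proof.
have [s [_ s2] [x0 xs x1]] := bary_simplex x.
have [k ks] : exists k : 'I_3, k \notin s.
  apply: contrapT => nk; move: s2; apply/negP; rewrite -ltnNge.
  have /card_uniqP <- := fset_uniq s.
  rewrite (eq_card (B := predT)) ?card_ord// => i.
  by rewrite !inE; apply: contrapT => /negP si; apply: nk; exists i.
have sum1 : \sum_i bary x i = 1.
  rewrite -[RHS]x1 [RHS]big_uniq ?fset_uniq//= [RHS]big_mkcond/=.
  by apply: eq_bigr => i _; case: ifPn => // /xs.
have xk := xs k ks.
pose a i := bary x (inord i).
have aE (i : 'I_3) : bary x i = a i by rewrite /a inord_val.
have a0 i : 0 <= a i by exact: x0.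
rewrite !big_ord_recr big_ord0 /= add0r !aE /= in sum1; rewrite aE in xk.
have fin (t : R) : 0 <= t <= 1 -> (forall i : 'I_3, a i = wind_coord t i) ->
    exists2 t, 0 <= t <= 1 & wind t = x.
  by move=> t01 at_; exists t => //; apply: bary_inj => i; rewrite aE at_.
have [a00 a10 a20] : [/\ 0 <= a 0%N, 0 <= a 1%N & 0 <= a 2%N] by [].
case: k ks xk => -[|[|[|//]]] k3 _ /= xk.
- apply: (fin ((1%:R + a 2%N) / 3)) => [|i]; first by apply/andP; split; lra.
  rewrite wind_coordE//; last by apply/andP; split; lra.
  by case: i => -[|[|[|//]]] ? /=; lra.
- apply: (fin ((2%:R + a 0%N) / 3)) => [|i]; first by apply/andP; split; lra.
  rewrite wind_coordE//; last by apply/andP; split; lra.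
  by case: i => -[|[|[|//]]] ? /=; lra.
- apply: (fin ((0%:R + a 1%N) / 3)) => [|i]; first by apply/andP; split; lra.
  rewrite wind_coordE//; last by apply/andP; split; lra.
  by case: i => -[|[|[|//]]] ? /=; lra.
Qed.

End triangle.

(** * Degree theory on the circle *)

Section circle_calculus.
Context (R : realType).
Local Notation C := (circ R).
Local Notation wind := (@wind R).

Lemma circ_hausdorff : hausdorff_space C.
Proof. exact: realization_hausdorff. Qed.

Lemma circ_compact : compact [set: C].
Proof.
have -> : [set: C] = wind @` `[0, 1]%classic.
  apply/seteqP; split=> // x _; have [t t01 <-] := wind_surj x.
  by exists t => //=; rewrite in_itv.
apply: continuous_compact; last exact: segment_compact.
exact/continuous_subspaceT/wind_continuous.
Qed.

(** This section of the covering cannot be continuous. *)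
Definition unwind (c : C) : R := projT1 (cid2 (wind_surj c)).

Lemma unwind_itv c : 0 <= unwind c <= 1.
Proof. by rewrite /unwind; case: cid2. Qed.

Lemma unwindK c : wind (unwind c) = c.
Proof. by rewrite /unwind; case: cid2. Qed.

(** Loops parametrized by the unit interval are maps on the circle. *)
Lemma circ_extension (U : topologicalType) (G : R -> U) :
  continuous G -> G 0 = G 1 ->
  exists2 g : C -> U, continuous g & forall s, 0 <= s <= 1 -> g (wind s) = G s.
Proof.
move=> cG G01; have gE s : 0 <= s <= 1 -> G (unwind (wind s)) = G s.
  move=> /andP[s0 s1]; have := unwind_itv (wind s).
  have [m ->] := wind_inj (unwindK (wind s)) => /andP[m0 m1].
  have m_gt : (-2)%:~R < (m%:~R : R) by rewrite intrN; lra.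
  have m_lt : (m%:~R : R) < 2%:~R by lra.
  rewrite !ltr_int in m_gt m_lt.
  have : [\/ m = -1, m = 0 | m = 1].
    case: m m_gt m_lt {m0 m1} => [[|[|m]]|[|m]] //= _ _; [exact: Or32|exact: Or33|exact: Or31].
  case=> mE; subst m; rewrite ?rmorphN ?rmorph1 ?rmorph0/= in m0 m1 *.
  - have -> : s = 1 by lra.
    by rewrite subrr.
  - by rewrite addr0.
  - have -> : s = 0 by lra.
    by rewrite add0r.
exists (G \o unwind) => //.
apply: (@continuous_from_compact R C U `[0, 1]%classic wind _ G) => //.
- exact: segment_compact.
- exact: circ_hausdorff.
- exact: wind_continuous.
- by move=> c; exists (unwind c); [rewrite /= in_itv/= unwind_itv|exact: unwindK].
Qed.

Lemma circ_extensionP (U : topologicalType) (g : C -> U) (G : R -> U) :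
  continuous G -> (forall s, g (wind s) = G s) -> continuous g.
Proof.
move=> cG gG; have G01 : G 0 = G 1.
  by rewrite -!gG -(windDz 0 1) add0r.
have [h ch hG] := circ_extension cG G01; suff -> : g = h by [].
by apply/funext => c; have [s s01 <-] := wind_surj c; rewrite hG ?gG.
Qed.

Definition cadd (c d : C) : C := wind (unwind c + unwind d).

Lemma caddE s t : cadd (wind s) (wind t) = wind (s + t).
Proof.
rewrite /cadd.
have [m ->] := wind_inj (unwindK (wind s)).
have [n ->] := wind_inj (unwindK (wind t)).
by rewrite addrACA -intrD windDz.
Qed.

Lemma cadd_continuous : continuous (fun z : C * C => cadd z.1 z.2).
Proof.
apply: (@continuous_from_compact (R * R)%type (C * C)%type C (`[0, 1] `*` `[0, 1])
  (fun z => (wind z.1, wind z.2)) _ (fun z => wind (z.1 + z.2))).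
- by apply: compact_setX; exact: segment_compact.
- exact: (hausdorff_prod circ_hausdorff circ_hausdorff).
- apply: continuous_pair.
    apply: (@continuous_comp_fun _ _ _ fst wind); last exact: wind_continuous.
    by move=> z; exact: cvg_fst.
  apply: (@continuous_comp_fun _ _ _ snd wind); last exact: wind_continuous.
  by move=> z; exact: cvg_snd.
- move=> [c d]; exists (unwind c, unwind d); rewrite /= ?unwindK//.
  by rewrite !in_itv/= !unwind_itv.
- apply: continuous_comp_fun; last exact: wind_continuous.
  exact: add_continuous.
- by move=> z _; rewrite caddE.
Qed.

Definition cpow (m : int) (c : C) : C := wind (m%:~R * unwind c).

Lemma cpowE m s : cpow m (wind s) = wind (m%:~R * s).
Proof.
rewrite /cpow; have [n ->] := wind_inj (unwindK (wind s)).
by rewrite mulrDr -intrM windDz.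
Qed.

Lemma cpow_continuous m : continuous (cpow m).
Proof.
apply: (@circ_extensionP _ _ (fun s => wind (m%:~R * s))); last exact: cpowE.
apply: continuous_comp_fun; last exact: wind_continuous.
by move=> s; apply: cvgM; [exact: cvg_cst|exact: cvg_id].
Qed.

Lemma cpowM m n c : cpow m (cpow n c) = cpow (m * n) c.
Proof. by have [s _ <-] := wind_surj c; rewrite !cpowE intrM mulrA. Qed.

Lemma cpow1 c : cpow 1 c = c.
Proof. by have [s _ <-] := wind_surj c; rewrite !cpowE mul1r. Qed.

Lemma caddA c d e : cadd c (cadd d e) = cadd (cadd c d) e.
Proof.
have [s _ <-] := wind_surj c; have [t _ <-] := wind_surj d.
by have [u _ <-] := wind_surj e; rewrite !caddE addrA.
Qed.

Definition cdist (c : C) : R := idist (unwind c).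

Lemma cdistE s : cdist (wind s) = idist s.
Proof. by rewrite /cdist; have [n ->] := wind_inj (unwindK (wind s)); rewrite idistDz. Qed.

Lemma cdist_continuous : continuous cdist.
Proof. by apply: (circ_extensionP (@idist_continuous R)); exact: cdistE. Qed.

(** A continuous function on the whole circle that inverts the covering near the base
point: lifted to the reals it is the triangle wave with slope 1 on
[[-1/4, 1/4]]. *)
Definition clog (c : C) : R := 1 / 4 - idist (unwind c - 1 / 4).

Lemma clogE s : clog (wind s) = 1 / 4 - idist (s - 1 / 4).
Proof.
rewrite /clog; have [n ->] := wind_inj (unwindK (wind s)).
by rewrite addrAC idistDz.
Qed.

Lemma clog_continuous : continuous clog.
Proof.
apply: (circ_extensionP _ clogE) => s; apply: cvgB; first exact: cvg_cst.
apply: (@continuous_comp _ _ _ (fun s : R => s - 1 / 4) (@idist R)); last exact: idist_continuous.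
by apply: cvgB; [exact: cvg_id|exact: cvg_cst].
Qed.

Lemma clogK c : cdist c < 1 / 4 -> wind (clog c) = c.
Proof.
have [s _ <-] := wind_surj c; rewrite cdistE; have [n ->] := idist_int s.
rewrite -(subrK n%:~R s) addrK windDz; move: (s - _) => {}s s4.
congr wind; rewrite clogE idist_small; move: s4; rewrite ltr_norml => /andP[? ?].
  by rewrite ler0_norm; lra.
by rewrite ler_norml; apply/andP; split; lra.
Qed.

Lemma real_clopen (B : set R) x : open B -> closed B -> B x -> forall y, B y.
Proof.
move=> oB cB Bx y; have : connected [set: R] by apply/connected_intervalP.
by move=> /(_ B) -> //; [exists x|exists B => //; rewrite setTI|exists B => //; rewrite setTI].
Qed.

Definition shifted (Z : topologicalType) (f g : Z -> C) :=
  exists2 dl : Z -> R, continuous dl & forall z, g z = cadd (f z) (wind (dl z)).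

Lemma shifted_refl (Z : topologicalType) (f : Z -> C) : shifted f f.
Proof.
exists (fun=> 0); first by move=> z; exact: cvg_cst.
by move=> z; have [s _ <-] := wind_surj (f z); rewrite caddE addr0.
Qed.

Lemma shifted_sym (Z : topologicalType) (f g : Z -> C) : shifted f g -> shifted g f.
Proof.
move=> [dl cdl gE]; exists (fun z => - dl z).
  by move=> z; apply: cvgN; exact: cdl.
by move=> z; rewrite gE -caddA caddE subrr; have [s _ <-] := wind_surj (f z); rewrite caddE addr0.
Qed.

Lemma shifted_trans (Z : topologicalType) (g f h : Z -> C) :
  shifted f g -> shifted g h -> shifted f h.
Proof.
move=> [dl cdl gE] [ep cep hE]; exists (fun z => dl z + ep z).
  by move=> z; apply: cvgD; [exact: cdl|exact: cep].
by move=> z; rewrite hE gE -caddA caddE.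
Qed.

Lemma shifted_homotopic (Z : topologicalType) (f g : Z -> C) :
  continuous f -> shifted f g -> homotopic R f g.
Proof.
move=> cf [dl cdl gE]; apply/homotopicP.
exists (fun z => cadd (f z.1) (wind (z.2 * dl z.1))); split=> [|z|z] /=.
- apply: (@continuous_comp_fun _ _ _ (fun z : Z * R => (f z.1, wind (z.2 * dl z.1)))
    (fun z : C * C => cadd z.1 z.2)); last exact: cadd_continuous.
  have fst_cont : continuous (@fst Z R) by move=> ?; exact: cvg_fst.
  apply: continuous_pair; first exact: (continuous_comp_fun fst_cont cf).
  apply: (@continuous_comp_fun _ _ _ (fun z : Z * R => z.2 * dl z.1) wind);
    last exact: wind_continuous.
  by move=> z; apply: cvgM; [exact: cvg_snd|exact: (continuous_comp_fun fst_cont cdl)].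
- by rewrite mul0r; have [s _ <-] := wind_surj (f z); rewrite caddE addr0.
- by rewrite mul1r gE.
Qed.

(** Along a homotopy on a compact space, nearby stages are uniformly close, so their
difference lifts through the logarithm; lifts add up, and the real line is
connected. *)
Lemma homotopic_shifted (Z : topologicalType) (f g : Z -> C) :
  compact [set: Z] -> homotopic R f g -> shifted f g.
Proof.
move=> cZ /homotopicP[H [cH /funext H0 /funext H1]].
pose Ht t z := H (z, t).
have -> : f = Ht 0 by rewrite -H0. have -> : g = Ht 1 by rewrite -H1.
pose diff (z : Z) t s := cadd (Ht s z) (cpow (-1) (Ht t z)).
have cpair (W : topologicalType) (a b : W -> Z * R) : continuous a -> continuous b ->
    continuous (fun w => cadd (H (a w)) (cpow (-1) (H (b w)))).
  move=> ca cb; apply: (@continuous_comp_fun _ _ _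
    (fun w => (H (a w), cpow (-1) (H (b w)))) (fun z : C * C => cadd z.1 z.2));
    last exact: cadd_continuous.
  apply: continuous_pair; first exact: (continuous_comp_fun ca cH).
  exact: (continuous_comp_fun (continuous_comp_fun cb cH) (@cpow_continuous _)).
have cst_cont (U W : topologicalType) (w : W) : continuous (fun _ : U => w).
  by move=> u; exact: cvg_cst.
have id_cont (U : topologicalType) : continuous (fun u : U => u).
  by move=> u; exact: cvg_id.
have near_t t : \forall s \near t, shifted (Ht t) (Ht s).
  have : \forall s \near t, [set: Z] `<=` [set z | cdist (diff z t s) < 1 / 4].
    have /compact_near_coveringP nZ := cZ.
    apply: (nZ R (nbhs t) (fun s z => cdist (diff z t s) < 1 / 4)) => z _.
    pose D (w : Z * R) := cdist (diff w.1 t w.2).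
    have cD : continuous D.
      apply: (@continuous_comp_fun _ _ _ (fun w : Z * R => diff w.1 t w.2) cdist);
        last exact: cdist_continuous.
      apply: cpair; apply: continuous_pair => w; by [exact: cvg_fst|exact: cvg_snd|exact: cvg_cst].
    have : nbhs (z, t) [set w | D w < 1 / 4].
      apply: (cD (z, t) [set r | r < 1 / 4]); apply: open_nbhs_nbhs.
      split; first exact: open_lt.
      rewrite /= /D /diff /Ht /=; have [s _ <-] := wind_surj (H (z, t)).
      rewrite cpowE caddE mulN1r subrr cdistE idist_small normr0; lra.
    by [].
  apply: filterS => s near_s; exists (fun z => clog (diff z t s)).
    apply: (@continuous_comp_fun _ _ _ (fun z => diff z t s) clog); last exact: clog_continuous.
    by apply: cpair; apply: continuous_pair.
  move=> z; rewrite clogK; last exact: (near_s z).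
  rewrite /diff; have [u _ <-] := wind_surj (Ht s z); have [v _ <-] := wind_surj (Ht t z).
  by rewrite cpowE !caddE mulN1r addrCA subrr addr0.
apply: (@real_clopen [set t | shifted (Ht 0) (Ht t)] 0 _ _ _ 1).
- rewrite openE => t sh0t; have := near_t t; apply: filterS => s.
  exact: shifted_trans.
- rewrite -[X in closed X]setCK; apply: open_closedC; rewrite openE => t nsh0t; have := near_t t.
  by apply: filterS => s /shifted_sym sst /shifted_trans/(_ sst).
- exact: shifted_refl.
Qed.

(** The reals are connected and the integers are discrete. *)
Lemma int_valued_const (j : R -> R) : continuous j ->
  (forall s, exists m : int, j s = m%:~R) -> forall s t, j s = j t.
Proof.
move=> cj jint s; have cl1 : closed [set j s] by exact: closed_eq.
have clB : closed (j @^-1` [set j s]) by apply: closed_comp => // u _; exact: cj.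
move=> t; apply/esym; apply: (@real_clopen (j @^-1` [set j s]) s) => //.
rewrite openE => u /= <-; have : nbhs u (j @^-1` ball (j u) 1).
  by apply: cj; exact: nbhsx_ballx.
apply: filterS => v; rewrite /ball/=.
have [m ->] := jint u; have [n ->] := jint v.
move=> mn; have : `|m - n|%:~R < 1%:~R :> R by rewrite intr_norm intrB.
rewrite ltr_int => {}mn; suff /eqP : m - n == 0 by move=> /subr0_eq ->.
by rewrite -normr_eq0; case: `|m - n| (normr_ge0 (m - n)) mn => -[].
Qed.

(** A lift [dl] of the quotient of the two power maps differs from a linear function
of slope [n - m] by an integer-valued continuous function, hence by a constant;
but [dl] takes the same value at both ends of a period. *)
Lemma cpow_homotopic_inj (m n : int) : homotopic R (cpow m) (cpow n) -> m = n.
Proof.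
move=> /(homotopic_shifted circ_compact)[dl cdl dlE].
pose j (s : R) := dl (wind s) - (n%:~R - m%:~R) * s.
have cj : continuous j.
  move=> s; apply: cvgB; first by apply: continuous_comp; [exact: wind_continuous|exact: cdl].
  by apply: cvgM; [exact: cvg_cst|exact: cvg_id].
have jint s : exists k : int, j s = k%:~R.
  have := dlE (wind s); rewrite !cpowE caddE => /wind_inj[k kE].
  by exists (- k); rewrite /j intrN; lra.
have := int_valued_const cj jint 0 1; rewrite /j -(windDz 0 1) add0r mulr0 mulr1.
by move=> nm; apply/eqP; rewrite -(eqr_int R); apply/eqP; lra.
Qed.

(** The path [f \o wind] on the unit interval lifts because it can be contracted to its
origin. Since homotopies are lifted over compact spaces, the interval is replaced
by the circle folded onto it by twice the distance to the base point. The
integer [m] is the increment of the lift over one period, and subtracting the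
linear function of slope [m] leaves a periodic function. *)
Lemma circ_map_homotopic (f : C -> C) : continuous f ->
  exists m : int, homotopic R f (cpow m).
Proof.
move=> cf.
have hom : homotopic R (fun _ : C => f (wind 0)) (fun c => f (wind (2 * cdist c))).
  apply/homotopicP; exists (fun z : C * R => f (wind (z.2 * (2 * cdist z.1)))).
  split=> [|c|c] /=; rewrite ?mul0r ?mul1r//.
  apply: (@continuous_comp_fun _ _ _ (fun z : C * R => wind (z.2 * (2 * cdist z.1))) f) => //.
  apply: (@continuous_comp_fun _ _ _ (fun z : C * R => z.2 * (2 * cdist z.1)) wind);
    last exact: wind_continuous.
  move=> z; apply: cvgM; first exact: cvg_snd.
  apply: cvgM; first exact: cvg_cst.
  by apply: (@continuous_comp _ _ _ fst cdist); [exact: cvg_fst|exact: cdist_continuous].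
have [dl cdl dlE] := homotopic_shifted circ_compact hom.
pose phi s := dl (wind (s / 2)).
have cphi : continuous phi.
  apply: (@continuous_comp_fun _ _ _ (fun s : R => s / 2) (fun s => dl (wind s))).
    by move=> s; apply: cvgM; [exact: cvg_id|exact: cvg_cst].
  exact: (continuous_comp_fun (@wind_continuous R) cdl).
pose a := unwind (f (wind 0)).
have fE s : 0 <= s <= 1 -> f (wind s) = wind (a + phi s).
  move=> /andP[s0 s1]; have := dlE (wind (s / 2)); rewrite cdistE idist_small.
    rewrite ger0_norm; last by lra.
    by rewrite mulrC divfK// => ->; rewrite -caddE unwindK.
  by rewrite ger0_norm; lra.
have [m0 phi0] : exists m : int, phi 0 = m%:~R.
  have := fE 0; rewrite lexx ler01 => /(_ isT); rewrite -{1}(unwindK (f (wind 0))) -/a.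
  by move=> /wind_inj[m mE]; exists (- m); rewrite intrN; lra.
have [m1 phi1] : exists m : int, phi 1 = m%:~R.
  have w1 : wind 1 = wind 0 by rewrite -(windDz 0 1) add0r.
  have := fE 1; rewrite lexx ler01 w1 => /(_ isT).
  rewrite -{1}(unwindK (f (wind 0))) -/a.
  by move=> /wind_inj[m mE]; exists (- m); rewrite intrN; lra.
pose G s := a + phi s - (m1 - m0)%:~R * s.
have cG : continuous G.
  move=> s; apply: cvgB; first by apply: cvgD; [exact: cvg_cst|exact: cphi].
  by apply: cvgM; [exact: cvg_cst|exact: cvg_id].
have [|g cg gE] := circ_extension cG.
  by rewrite /G phi0 phi1 intrB; lra.
exists (m1 - m0); apply: homotopic_sym; apply: shifted_homotopic.
  exact: cpow_continuous.
exists g => // c; have [s s01 <-] := wind_surj c.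
by rewrite cpowE gE// caddE fE//; congr wind; rewrite /G [RHS]addrC subrK.
Qed.

End circle_calculus.

(** * Homotopy classes of maps on a limit of circles *)

Section continuity_of_homotopy_sets.
Context (R : realType).
Local Notation C := (circ R).
Context (X : topologicalType) (I : Type) (le : I -> I -> Prop) (u : I -> X -> C).
Hypothesis I0 : inhabited I.
Hypothesis cX : compact [set: X].
Hypothesis cu : forall i, continuous (u i).
Hypothesis u_surj : forall i c, exists x, u i x = c.
Hypothesis le_refl : forall i, le i i.
Hypothesis le_trans : forall j i k, le i j -> le j k -> le i k.
Hypothesis le_dir : forall i j, exists k, le i k /\ le j k.
Hypothesis u_le : forall i j, le i j -> forall x y, u j x = u j y -> u i x = u i y.
Hypothesis u_sep : forall x y, (forall i, u i x = u i y) -> x = y.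

Section polyhedron.
Context (V : choiceType) (K : simplicial_complex V).
Local Notation P := (realization R K).

Lemma polyhedron_map_factors (f : X -> P) : continuous f ->
  exists i (g : C -> P), continuous g /\ homotopic R f (g \o u i).
Proof.
move=> cf; case: I0 => i0.
have [i _ iP] := fibers_in_stars cX (@circ_hausdorff R) cu le_refl le_trans le_dir
  u_le u_sep i0 cf.
have [|g cg gP] := simplicial_approximation cX (@circ_compact R) (@circ_hausdorff R)
  (@cu i) (u_surj i) cf.
  by move=> c; have [x <-] := u_surj i c; exact: iP.
exists i, g; split=> //; apply: contiguous_homotopic => //.
exact: continuous_comp_fun (@cu i) cg.
Qed.

(** A homotopy parametrized by the unit interval is a map on [X * C], because the
circle folds onto the interval. Approximating it over [C * C] gives a homotopy
between maps on the circle whose ends are contiguous to [g0 \o T] and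
[g1 \o T], as [u j] is onto. *)
Lemma polyhedron_homotopy_factors (i : I) (g0 g1 : C -> P) :
  continuous g0 -> continuous g1 -> homotopic R (g0 \o u i) (g1 \o u i) ->
  exists j (T : C -> C), [/\ le i j, continuous T, forall x, T (u j x) = u i x &
    homotopic R (g0 \o T) (g1 \o T)].
Proof.
move=> cg0 cg1 /homotopicP[H [cH H0 H1]].
pose F (z : X * C) := H (z.1, 2 * cdist z.2).
have cfst (S T : topologicalType) : continuous (@fst S T) by move=> ?; exact: cvg_fst.
have csnd (S T : topologicalType) : continuous (@snd S T) by move=> ?; exact: cvg_snd.
have ccst (S T : topologicalType) (t : T) : continuous (fun _ : S => t).
  by move=> ?; exact: cvg_cst.
have cid_ (S : topologicalType) : continuous (fun s : S => s) by move=> ?; exact: cvg_id.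
have cF : continuous F.
  apply: (@continuous_comp_fun _ _ _ (fun z : X * C => (z.1, 2 * cdist z.2)) H) => //.
  apply: continuous_pair; first exact: cfst.
  move=> z; apply: cvgM; first exact: cvg_cst.
  exact: (continuous_comp_fun (csnd X C) (@cdist_continuous R)).
pose q i (z : X * C) := (u i z.1, z.2).
have cXC : compact [set: X * C].
  have -> : [set: X * C] = [set: X] `*` [set: C] by apply/seteqP; split.
  by apply: compact_setX => //; exact: circ_compact.
have cCC : compact [set: C * C].
  have -> : [set: C * C] = [set: C] `*` [set: C] by apply/seteqP; split.
  by apply: compact_setX => //; exact: circ_compact.
have hCC : hausdorff_space (C * C)%type by apply: hausdorff_prod; exact: circ_hausdorff.
have cq j : continuous (q j).
  by apply: continuous_pair; [|exact: csnd]; exact: continuous_comp_fun (cfst _ _) (@cu j).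
have [||j ij jP] := fibers_in_stars cXC hCC cq le_refl le_trans le_dir _ _ i cF.
- by move=> j k jk [x c] [y d] [/(u_le jk) uxy ->]; rewrite /q /= uxy.
- move=> [x c] [y d] xy; have -> : c = d by case: (xy i).
  by congr pair; apply: u_sep => j; case: (xy j).
have [||h ch hP] := simplicial_approximation cXC cCC hCC (cq j) _ cF.
- by move=> [b c]; have [x <-] := u_surj j b; exists (x, c).
- by move=> [b c]; have [x <-] := u_surj j b; exact: jP (x, c).
have [T cT TP] := factor_through cX (@circ_hausdorff R) (@cu j) (u_surj j) (@cu i) (u_le ij).
exists j, T; split=> //.
have ch_ (c : C) : continuous (fun b => h (b, c)).
  apply: (@continuous_comp_fun _ _ _ (fun b : C => (b, c)) h) => //.
  by apply: continuous_pair; [exact: cid_|exact: ccst].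
have contig (g : C -> P) (c : C) : continuous g ->
    (forall x, H (x, 2 * cdist c) = g (u i x)) -> homotopic R (g \o T) (fun b => h (b, c)).
  move=> cg gH; apply: contiguous_homotopic => //; first exact: circ_compact.
    exact: continuous_comp_fun cT cg.
  move=> b v; have [x <-] := u_surj j b; rewrite /= TP -gH => Fv.
  exact: (hP (x, c)).
apply: (homotopic_trans (contig g0 (wind 0) cg0 _)) => [x|].
  by rewrite cdistE idist_small normr0 ?mulr0 ?H0//; lra.
apply: (@homotopic_trans _ _ _ (fun b => h (b, wind (1 / 2)))); last first.
  apply: homotopic_sym; apply: contig => // x.
  by rewrite cdistE idist_small ger0_norm ?mulrA ?mulr1 ?divff ?H1//; lra.
apply/homotopicP; exists (fun z => h (z.1, wind (z.2 / 2))); split=> [|b|b] /=.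
- apply: (@continuous_comp_fun _ _ _ (fun z : C * R => (z.1, wind (z.2 / 2))) h) => //.
  apply: continuous_pair; first exact: cfst.
  apply: (@continuous_comp_fun _ _ _ (fun z : C * R => z.2 / 2) (@wind R));
    last exact: wind_continuous.
  by move=> z; apply: cvgM; [exact: cvg_snd|exact: cvg_cst].
- by rewrite mul0r.
- by [].
Qed.

End polyhedron.

Section dominated.
Context (W : shape_obj R).

Lemma map_factors (f : X -> W) : continuous f ->
  exists i (g : C -> W), continuous g /\ homotopic R f (g \o u i).
Proof.
move=> cf; have [V [K [a [b ba]]]] := shape_dominated W.
have ca : continuous a by exact: cts_fun.
have cb : continuous b by exact: cts_fun.
have [i [g [cg fg]]] := polyhedron_map_factors (continuous_comp_fun cf ca).
exists i, (b \o g); split; first exact: continuous_comp_fun.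
apply: (@homotopic_trans _ _ _ (b \o (a \o f))).
  apply: homotopic_sym.
  apply: (@homotopic_comp R X W W f f (b \o a) idfun) => //; last exact: homotopic_refl.
  by move=> w; exact: cvg_id.
by apply: homotopic_comp => //;
  [exact: continuous_comp_fun|exact: homotopic_refl].
Qed.

Lemma homotopy_factors (i : I) (g0 g1 : C -> W) :
  continuous g0 -> continuous g1 -> homotopic R (g0 \o u i) (g1 \o u i) ->
  exists j (T : C -> C), [/\ le i j, continuous T, forall x, T (u j x) = u i x &
    homotopic R (g0 \o T) (g1 \o T)].
Proof.
move=> cg0 cg1 g01; have [V [K [a [b ba]]]] := shape_dominated W.
have ca : continuous a by exact: cts_fun.
have cb : continuous b by exact: cts_fun.
have cui := @cu i.
have [|j [T [ij cT TP hom]]] := @polyhedron_homotopy_factors V K i (a \o g0) (a \o g1)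
    (continuous_comp_fun cg0 ca) (continuous_comp_fun cg1 ca).
  apply: (@homotopic_comp R X W (realization R K) _ _ a a) => //.
    exact: continuous_comp_fun.
  exact: homotopic_refl.
exists j, T; split=> //.
have back (g : C -> W) : continuous g -> homotopic R (b \o (a \o (g \o T))) (g \o T).
  move=> cg; have cgT := continuous_comp_fun cT cg.
  apply: (@homotopic_comp R C W W (g \o T) (g \o T) (b \o a) idfun) => //;
    last exact: homotopic_refl.
  by move=> w; exact: cvg_id.
apply: (homotopic_trans (homotopic_sym (back g0 cg0))).
apply: (@homotopic_trans _ _ _ (b \o (a \o (g1 \o T)))); last exact: back.
apply: homotopic_comp => //; last exact: homotopic_refl.
exact: (continuous_comp_fun cT (continuous_comp_fun cg0 ca)).
Qed.

End dominated.

End continuity_of_homotopy_sets.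

(** * Monotone functions on an ordered continuum *)

Section ramps.
Context (R : realType) (d : Order.disp_t) (L : orderTopologicalType d).
Hypothesis hL : ordered_continuum L.

(** Otherwise the open initial segments form a directed cover without largest
element. *)
Lemma last_point_exists : exists x : L, last_point x.
Proof.
have [[x0 _] cL _] := hL.
apply: contrapT => nolast.
have [|||i iP] := @compact_directed L L (fun i j => (i <= j)%O) (fun i z => (z <= i)%O)
  cL (inhabits x0) (@le_refl _ L) (fun j i k => @le_trans _ L j i k).
- by move=> i j; exists (Order.max i j); rewrite !le_max !lexx orbT.
- by move=> i j z ij /le_trans; exact.
- move=> z; have [y zy] : exists y, (z < y)%O.
    apply: contrapT => ny; apply: nolast; exists z => y.
    by rewrite leNgt; apply/negP => zy; apply: ny; exists y.
  exists y; apply: (@filterS _ (nbhs z) _ `]-oo, y[%classic).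
    by move=> w /=; rewrite in_itv/= => /ltW.
  by apply: open_nbhs_nbhs; split; [exact: lray_open|rewrite /= in_itv].
- by apply: nolast; exists i.
Qed.

Lemma first_point_exists : exists x : L, first_point x.
Proof.
have [[x0 _] cL _] := hL.
apply: contrapT => nofirst.
have [|||i iP] := @compact_directed L L (fun i j => (j <= i)%O) (fun i z => (i <= z)%O)
  cL (inhabits x0) (@le_refl _ L) (fun j i k ij jk => @le_trans _ L j k i jk ij).
- by move=> i j; exists (Order.min i j); rewrite !ge_min !lexx orbT.
- by move=> i j z ji iz; exact: le_trans ji iz.
- move=> z; have [y zy] : exists y, (y < z)%O.
    apply: contrapT => ny; apply: nofirst; exists z => y.
    by rewrite leNgt; apply/negP => zy; apply: ny; exists y.
  exists y; apply: (@filterS _ (nbhs z) _ `]y, +oo[%classic).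
    by move=> w /=; rewrite in_itv/= andbT => /ltW.
  by apply: open_nbhs_nbhs; split; [exact: rray_open|rewrite /= in_itv/= andbT].
- by apply: nofirst; exists i.
Qed.

Lemma first_not_last (x : L) : first_point x -> ~ last_point x.
Proof.
move=> fx lx; have [[a [b /eqP ab]] _ _] := hL; apply: ab.
by apply/le_anti; rewrite !(le_trans (lx _) (fx _)).
Qed.

(** Monotonicity is what makes these functions directed: the mean of two of them
identifies two points only if both do. *)
Record ramp := Ramp {
  ramp_fun :> L -> R;
  ramp_continuous : continuous ramp_fun;
  ramp_mono : forall x y, (x <= y)%O -> ramp_fun x <= ramp_fun y;
  ramp_first : forall x, first_point x -> ramp_fun x = 0;
  ramp_last : forall x, last_point x -> ramp_fun x = 1 }.

Lemma ramp_itv (v : ramp) x : 0 <= v x <= 1.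
Proof.
have [f fP] := first_point_exists; have [l lP] := last_point_exists.
by rewrite -(ramp_first v fP) -(ramp_last v lP) !ramp_mono.
Qed.

(** The supremum of [f] over an initial segment varies no more than [f] does on an
interval around its endpoint. *)
Lemma running_max (f : L -> R) : continuous f -> (forall x, 0 <= f x <= 1) ->
  exists g : L -> R, [/\ continuous g, forall x y, (x <= y)%O -> g x <= g y,
    forall x, f x <= g x &
    forall x (b : R), (forall y, (y <= x)%O -> f y <= b) -> g x <= b].
Proof.
move=> cf f01; pose g x := sup (f @` [set y | (y <= x)%O]).
have hs x : has_sup (f @` [set y | (y <= x)%O]).
  split; first by exists (f x), x => //=.
  by exists 1 => _ [y _ <-]; case/andP: (f01 y).
have fg y x : (y <= x)%O -> f y <= g x.
  by move=> yx; apply: ub_le_sup; [exact: (hs x).2|exists y].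
have gb x (b : R) : (forall y, (y <= x)%O -> f y <= b) -> g x <= b.
  by move=> fb; apply: ge_sup; [exact: (hs x).1|move=> _ [y yx <-]; exact: fb].
have gm x y : (x <= y)%O -> g x <= g y.
  by move=> xy; apply: gb => z zx; apply: fg; exact: le_trans zx xy.
exists g; split=> //; last by move=> x; exact: fg.
move=> z; apply/cvgrPdist_le => e e0.
have : nbhs z [set w | `|f z - f w| <= e / 2].
  by move/cvgrPdist_le: (cf z); apply; lra.
rewrite itv_nbhsE => -[i [oi zi] ie].
have conv w u : w \in i -> ((w <= u <= z) || (z <= u <= w))%O -> `|f z - f u| <= e / 2.
  move=> wi wuz; apply: ie; case/orP: wuz; exact: itv_convex.
have iz : nbhs z [set` i] by rewrite itv_nbhsE; exists i.
apply: filterS iz => w wi.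
have := conv w w wi; rewrite !lexx /= !andbT le_total => /(_ isT).
rewrite !ler_norml => /andP[fw1 fw2].
have [zw|wz] := leP z w.
  have := gm _ _ zw => gzw.
  have : g w <= g z + e / 2.
    apply: gb => u uw; have [uz|zu] := leP u z; first by have := fg _ _ uz; lra.
    have := conv w u wi; rewrite uw (ltW zu) orbT ler_norml => /(_ isT)/andP[? ?].
    by have := fg z z (lexx z); lra.
  by move=> ?; apply/andP; split; lra.
have gwz := gm _ _ (ltW wz).
have : g z <= g w + e.
  apply: gb => u uz; have [uw|wu] := leP u w; first by have := fg _ _ uw; lra.
  have := conv w u wi; rewrite uz (ltW wu) ler_norml => /(_ isT)/andP[? ?].
  by have := fg w w (lexx w); lra.
by move=> ?; apply/andP; split; lra.
Qed.

(** The running maximum of a Urysohn function for the closed segments below [x] and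
above [y]. *)
Lemma ramp_separates (x y : L) : (x < y)%O -> exists v : ramp, v x = 0 /\ v y = 1.
Proof.
move=> xy; have [_ cL _] := hL.
have dis : `]-oo, x]%classic `&` `[y, +oo[%classic = set0 :> set L.
  apply/seteqP; split=> // z [/=]; rewrite !in_itv/= andbT => zx yz.
  by have := lt_le_trans xy (le_trans yz zx); rewrite ltxx.
have /(@uniform_separatorP _ R)[f [cf f01 f0 f1]] :=
  (@normal_separatorP R L).1 (compact_normal order_hausdorff cL) _ _
  (@lray_closed _ L x) (@rray_closed _ L y) dis.
have f01' z : 0 <= f z <= 1.
  by have := f01 (f z) (ex_intro2 _ _ z I erefl); rewrite /= in_itv.
have [g [cg gm fg gb]] := running_max cf f01'.
have g0 z : (z <= x)%O -> g z = 0.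
  move=> zx; apply/le_anti/andP; split; last first.
    by apply: le_trans (fg z); case/andP: (f01' z).
  by apply: gb => w wz; rewrite (f0 (f w))//; exists w => //; rewrite /= in_itv/= (le_trans wz).
have g1 z : (y <= z)%O -> g z = 1.
  move=> yz; apply/le_anti/andP; split.
    by apply: gb => w _; case/andP: (f01' w).
  by rewrite -(f1 (f z)) ?fg//; exists z => //; rewrite /= in_itv/= yz.
by exists (@Ramp g cg gm (fun z fz => g0 z (fz x)) (fun z lz => g1 z (lz y))); rewrite /= g0// g1.
Qed.

Lemma ramp_exists : inhabited ramp.
Proof.
have [f fP] := first_point_exists; have [l lP] := last_point_exists.
have fl : (f < l)%O.
  by rewrite lt_neqAle lP andbT; apply/eqP => fl; apply: (first_not_last fP); rewrite fl.
by have [v _] := ramp_separates fl; split.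
Qed.

Lemma ramp_mean (v w : ramp) : exists z : ramp, forall x, z x = (v x + w x) / 2.
Proof.
have cz : continuous (fun x => (v x + w x) / 2).
  move=> x; apply: cvgM; last exact: cvg_cst.
  by apply: cvgD; exact: ramp_continuous.
have mz x y : (x <= y)%O -> (v x + w x) / 2 <= (v y + w y) / 2.
  by move=> xy; have := ramp_mono v xy; have := ramp_mono w xy; lra.
have z0 x : first_point x -> (v x + w x) / 2 = 0.
  by move=> fx; rewrite !ramp_first// addr0 mul0r.
have z1 x : last_point x -> (v x + w x) / 2 = 1.
  by move=> fx; rewrite !ramp_last//; lra.
by exists (Ramp cz mz z0 z1).
Qed.

Lemma ramp_surj (v : ramp) r : 0 <= r <= 1 -> exists x, v x = r.
Proof.
move=> r01; have [_ _ conL] := hL.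
have [f fP] := first_point_exists; have [l lP] := last_point_exists.
have : connected (v @` [set: L]).
  apply: connected_continuous_connected => //.
  exact/continuous_subspaceT/ramp_continuous.
move=> /connected_intervalP vint.
have [||x _ <-] := vint 0 1 _ _ r r01; last by exists x.
  by exists f => //; exact: ramp_first.
by exists l => //; exact: ramp_last.
Qed.

End ramps.

(** * Maps on a circle of arcs *)

Section circle_of_arcs.
Local Open Scope quotient_scope.
Context (d : Order.disp_t) (L : orderTopologicalType d) (k : nat).
Local Notation S := (circle L k).

Lemma circle_pt_surj (u : S) : exists i x, u = circle_pt i x.
Proof.
case E : (repr (repr u : chain L k)) => [i x]; exists i, x.
by rewrite /circle_pt /chain_pt -E reprK [RHS]reprK.
Qed.

Lemma circle_pt_continuous (i : 'I_k) : continuous (@circle_pt d L k i).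
Proof.
apply: (@continuous_comp_fun _ _ _ (@chain_pt d L k i) (\pi_S)); last first.
  exact: (@pi_continuous (chain L k) (circle L k)).
apply: (@continuous_comp_fun _ _ _ (existT (fun=> L : Type) i) (\pi_(chain L k))).
  exact: existT_continuous.
exact: (@pi_continuous {i : 'I_k & L} (chain L k)).
Qed.

Lemma circle_compact : compact [set: L] -> compact [set: S].
Proof.
move=> cL; have -> : [set: S] = (\pi_S \o \pi_(chain L k)) @` [set: {i : 'I_k & L}].
  apply/seteqP; split=> // u _; have [i [x ->]] := circle_pt_surj u.
  by exists (existT _ i x).
apply: continuous_compact.
  apply: continuous_subspaceT; apply: continuous_comp_fun.
    exact: (@pi_continuous {i : 'I_k & L} (chain L k)).
  exact: (@pi_continuous (chain L k) (circle L k)).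
exact: (@sigT_compact 'I_k (fun=> L) (@finite_finset _ _) (fun=> cL)).
Qed.

(** The universal property of the circle of arcs: maps on the arcs that agree at the
junctions, taken cyclically, glue. *)
Lemma circle_lift (U : topologicalType) (g : 'I_k -> L -> U) :
  (forall i, continuous (g i)) ->
  (forall (i j : 'I_k) a b, last_point a -> first_point b ->
     j = (i.+1 %% k)%N :> nat -> g i a = g j b) ->
  exists2 G : S -> U, continuous G & forall i x, G (circle_pt i x) = g i x.
Proof.
move=> cg gjoin.
have gchain i j x y : chain_pt i x = chain_pt j y -> g i x = g j y.
  move=> /chain_ptP /=.
  have same (a b : L) : first_point a -> first_point b -> a = b.
    by move=> fa fb; apply/le_anti; rewrite fa fb.
  have next (l m : 'I_k) : l.+1 = m :> nat -> m = (l.+1 %% k)%N :> nat.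
    by move=> lm; rewrite lm modn_small.
  case: (asboolP (last_point x)) => lx; case: (asboolP (last_point y)) => ly.
  - by move=> [/val_inj ->]; congr g; apply/le_anti; rewrite lx ly.
  - by case: (asboolP (first_point y)) => fy //= -[ij]; apply: gjoin => //; exact: next.
  - by case: (asboolP (first_point x)) => fx //= -[ij]; symmetry; apply: gjoin => //; exact: next.
  case: (asboolP (first_point x)) => fx; case: (asboolP (first_point y)) => fy //=.
  - by move=> [/val_inj ->]; congr g; exact: same.
  - by move=> [/val_inj -> ->].
have gbound i j x y : chain_boundary (chain_pt i x) -> chain_boundary (chain_pt j y) ->
    g i x = g j y.
  move=> [i' [x' [/gchain -> ix]]] [j' [y' [/gchain -> jy]]].
  have wrap (l m : 'I_k) : l.+1 = k -> m = 0%N :> nat -> m = (l.+1 %% k)%N :> nat.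
    by move=> lk m0; rewrite lk modnn.
  case: ix jy => -[i0 fx] [] [j0 fy].
  - have -> : i' = j' by apply: val_inj => /=; rewrite i0 j0.
    by congr g; apply/le_anti; rewrite fx fy.
  - by symmetry; apply: gjoin => //; exact: wrap.
  - by apply: gjoin => //; exact: wrap.
  - have -> : i' = j' by apply: val_inj; apply: succn_inj; exact: etrans i0 (esym j0).
    by congr g; apply/le_anti; rewrite fx fy.
pose G (u : S) := let: existT i x := repr (repr u : chain L k) in g i x.
have GE i x : G (circle_pt i x) = g i x.
  rewrite /G; case E : (repr (repr (circle_pt i x) : chain L k)) => [j y].
  have /circle_ptP[|[]] : circle_pt j y = circle_pt i x.
  - by rewrite {1}/circle_pt /chain_pt -E reprK [LHS]reprK.
  - exact: gchain.
  - exact: gbound.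
exists G => //.
apply/(@quotient_continuous (chain L k) (circle L k)).
apply/(@quotient_continuous {i : 'I_k & L} (chain L k)).
have -> : (G \o \pi_S) \o \pi_(chain L k) = mathcomp.classical.unstable.sigT_fun g.
  by apply/funext => -[i x]; exact: GE.
exact: sigT_continuous.
Qed.

Lemma circle_pt_join (i j : 'I_k) (a b : L) :
  ordered_continuum L -> last_point a -> first_point b ->
  j = (i.+1 %% k)%N :> nat -> circle_pt i a = circle_pt j b.
Proof.
move=> hL la fb jE; apply/circle_ptP; have := ltn_ord i; rewrite leq_eqVlt => /predU1P[ik|ik].
  right; split; [exists i, a|exists j, b]; split=> //; first by right.
  by left; rewrite jE ik modnn.
left; apply/chain_ptP; rewrite /= (asboolT la) (asboolT fb).
by rewrite (asboolF (first_not_last hL fb)) jE modn_small.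
Qed.

End circle_of_arcs.

Lemma circle_cover_continuous (d : Order.disp_t) (L : orderTopologicalType d) (m n : nat) :
  ordered_continuum L -> continuous (@circle_cover d L m n).
Proof.
move=> hL.
have [|i j a b la fb jE|G cG GE] := @circle_lift _ L (m * n) _
  (fun (i : 'I_(m * n)) x => circle_pt (ord_mod i) x).
- by move=> i; exact: circle_pt_continuous.
- apply: circle_pt_join => //=; rewrite jE.
  have n0 : (0 < n)%N by apply: leq_ltn_trans (modn_mul_ord i).
  by rewrite modn_dvdm ?dvdn_mull// -[(i %% n).+1]addn1 modnDml addn1.
suff -> : @circle_cover d L m n = G by [].
apply/funext => u; have [i [x ->]] := circle_pt_surj u.
by rewrite circle_coverE GE.
Qed.

Section wrapping.
Context (R : realType) (d : Order.disp_t) (L : orderTopologicalType d).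
Hypothesis hL : ordered_continuum L.
Local Notation ramp := (ramp R L).

Lemma modn_intE (k i : nat) : exists m : int, (i %% k)%:R = i%:R + m%:~R * k%:R :> R.
Proof.
exists (- (i %/ k)%:Z); rewrite {2}(divn_eq i k) natrD natrM intrN -pmulrn.
by rewrite mulNr addrAC subrr add0r.
Qed.

Lemma wrap_exists (k : nat) (v : ramp) : (0 < k)%N ->
  exists2 g : circle L k -> circ R, continuous g &
    forall (i : 'I_k) x, g (circle_pt i x) = wind ((i%:R + v x) / k%:R).
Proof.
move=> k0; have k0' : k%:R != 0 :> R by rewrite pnatr_eq0 -lt0n.
apply: circle_lift => [i|i j a b la fb ->].
  apply: (@continuous_comp_fun _ _ _ (fun x => (i%:R + v x) / k%:R) (@wind R)).
    move=> x; apply: cvgM; last exact: cvg_cst.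
    by apply: cvgD; [exact: cvg_cst|exact: ramp_continuous].
  exact: wind_continuous.
rewrite ramp_last// ramp_first// addr0; have [m ->] := modn_intE k i.+1.
by rewrite -natr1 [in RHS]mulrDl mulfK// windDz.
Qed.

Lemma shift_exists (k : nat) (v w : ramp) :
  exists2 g : circle L k -> R, continuous g &
    forall (i : 'I_k) x, g (circle_pt i x) = (w x - v x) / k%:R.
Proof.
apply: circle_lift => [i x|i j a b la fb _].
  apply: cvgM; last exact: cvg_cst.
  by apply: cvgB; exact: ramp_continuous.
by rewrite !(ramp_last _ la) !(ramp_first _ fb) !subrr.
Qed.

Section fixed_degree.
Context (k : nat) (k0 : (0 < k)%N).

(** The [i]th arc goes to the [i]th of [k] equal arcs of the circle, through the
monotone function [v]. *)
Definition wrap (v : ramp) : circle L k -> circ R := projT1 (cid2 (wrap_exists v k0)).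

Lemma wrap_continuous v : continuous (wrap v).
Proof. by rewrite /wrap; case: cid2. Qed.

Lemma wrapE v i x : wrap v (circle_pt i x) = wind ((i%:R + v x) / k%:R).
Proof. by rewrite /wrap; case: cid2. Qed.

Lemma wrap_eqP v (i j : 'I_k) x y :
  wrap v (circle_pt i x) = wrap v (circle_pt j y) <->
  exists m : int, i%:R + v x = j%:R + v y + m%:~R * k%:R.
Proof.
have k0' : k%:R != 0 :> R by rewrite pnatr_eq0 -lt0n.
rewrite !wrapE; split=> [/wind_inj[m E]|[m ->]]; exists m || idtac.
  by apply: (mulIf (invr_neq0 k0')); rewrite E [RHS]mulrDl mulfK.
by rewrite mulrDl mulfK// windDz.
Qed.

(** Points identified by [wrap v] have real parameters differing by a multiple of
[k], so [v x - v y] is an integer, of absolute value at most 1; when it is 1 or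
-1, [v] takes at the two points its values at the ends of the continuum, hence
so does the coarser [w], and all ramps agree there. *)
Lemma wrap_coarser_diff (v w : ramp) (i j : 'I_k) x y :
  (forall x y, v x = v y -> w x = w y) ->
  wrap v (circle_pt i x) = wrap v (circle_pt j y) -> w x - w y = v x - v y.
Proof.
move=> vw /wrap_eqP[m E].
have [f fP] := first_point_exists hL; have [l lP] := last_point_exists hL.
have := ramp_itv hL v x; have := ramp_itv hL v y => /andP[y0 y1] /andP[x0 x1].
(* The integer v x - v y, computed from the indices. *)
pose n : int := j%:Z - i%:Z + m * k%:Z.
have nE : v x - v y = n%:~R.
  by rewrite /n intrD intrB intrM -!pmulrn; lra.
have n_gt : (-2)%:~R < (n%:~R : R) by rewrite -nE intrN; lra.
have n_lt : (n%:~R : R) < 2%:~R by rewrite -nE; lra.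
rewrite !ltr_int in n_gt n_lt.
have : [\/ n = -1, n = 0 | n = 1].
  by case: (n) n_gt n_lt => [[|[|?]]|[|?]] //= _ _; [exact: Or32|exact: Or33|exact: Or31].
case=> nn; rewrite nE nn; rewrite nn ?rmorphN ?rmorph1 ?rmorph0/= in nE *.
- rewrite (vw x f) ?(ramp_first v fP); last by lra.
  by rewrite (vw y l) ?(ramp_last v lP) ?(ramp_first w fP) ?(ramp_last w lP); lra.
- by rewrite (vw x y) ?subrr//; lra.
- rewrite (vw x l) ?(ramp_last v lP); last by lra.
  by rewrite (vw y f) ?(ramp_first v fP) ?(ramp_first w fP) ?(ramp_last w lP); lra.
Qed.

Lemma wrap_coarser (v w : ramp) (a b : circle L k) :
  (forall x y, v x = v y -> w x = w y) -> wrap v a = wrap v b -> wrap w a = wrap w b.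
Proof.
have [i [x ->]] := circle_pt_surj a; have [j [y ->]] := circle_pt_surj b.
move=> vw vab; have E := wrap_coarser_diff vw vab.
by move: vab => /wrap_eqP[m Em]; apply/wrap_eqP; exists m; lra.
Qed.

Lemma half_not_int (n : int) : n%:~R <> 1 / 2 :> R.
Proof.
have [n0|n1] := leP n 0.
  have : (n%:~R : R) <= 0 by rewrite (ler_int _ n 0).
  lra.
have : (1%:~R : R) <= n%:~R by rewrite ler_int.
by rewrite rmorph1; lra.
Qed.

Lemma eq_mod_real (i j : nat) (m : int) :
  i%:R = j%:R + m%:~R * k%:R :> R -> (i = j %[mod k])%N.
Proof.
move=> E; have {}E : i%:Z = m * k%:Z + j%:Z.
  by apply: (@intr_inj R); rewrite intrD intrM -!pmulrn E addrC.
by apply/eqP; rewrite -eqz_nat -!modz_nat E modzMDl.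
Qed.

(** Points on arcs at different heights [x < y] are identified by a ramp equal to 0
at [x] and 1 at [y] only if their arcs are consecutive. If they are not the same
junction, some mean of two ramps separates the heights by exactly 1/2, and no
congruence of integers is compatible with that. *)
Lemma wrap_separates (a b : circle L k) : (forall v, wrap v a = wrap v b) -> a = b.
Proof.
have [i [x ->]] := circle_pt_surj a; have [j [y ->]] := circle_pt_surj b.
have [f fP] := first_point_exists hL; have [l lP] := last_point_exists hL.
have [v0] := ramp_exists R hL.
have main (i' j' : 'I_k) x' y' : (x' < y')%O ->
    (forall v, wrap v (circle_pt i' x') = wrap v (circle_pt j' y')) ->
    circle_pt i' x' = circle_pt j' y'.
  move=> xy vv; have [v [vx vy]] := ramp_separates R hL xy.
  have [m mE] : exists m : int, i'%:R = j'%:R + 1 + m%:~R * k%:R :> R.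
    by have /wrap_eqP[m] := vv v; rewrite vx vy addr0; exists m.
  (* A half-integral difference would turn mE into a parity contradiction. *)
  have noskew (w : ramp) : w y' - w x' <> 1 / 2.
    have /wrap_eqP[n nE] := vv w => wE.
    apply: (@half_not_int (1 + (m - n) * k%:Z)).
    by rewrite intrD intrM intrB -pmulrn rmorph1; lra.
  have fx : first_point x'.
    move=> z; rewrite leNgt; apply/negP => zx.
    have [v1 [v1z v1x]] := ramp_separates R hL zx.
    have [w wE] := ramp_mean v v1; apply: (noskew w); rewrite !wE vx vy v1x.
    have := ramp_mono v1 (ltW xy); have := ramp_itv hL v1 y'; rewrite v1x => /andP[? ?] ?.
    by lra.
  have ly : last_point y'.
    move=> z; rewrite leNgt; apply/negP => yz.
    have [v1 [v1y v1z]] := ramp_separates R hL yz.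
    have [w wE] := ramp_mean v v1; apply: (noskew w); rewrite !wE vx vy v1y.
    have := ramp_mono v1 (ltW xy); have := ramp_itv hL v1 x'; rewrite v1y => /andP[? ?] ?.
    by lra.
  symmetry; apply: circle_pt_join => //.
  by rewrite -(modn_small (ltn_ord i')); apply: (@eq_mod_real _ _ m); rewrite -natr1.
move=> ab; have [xy|yx|xy] := ltgtP x y; first exact: main.
  by symmetry; apply: main => // v; rewrite ab.
move: (ab v0); rewrite xy => /wrap_eqP[m E]; congr circle_pt; apply: val_inj => /=.
have /eq_mod_real : i%:R = j%:R + m%:~R * k%:R :> R by lra.
by rewrite !modn_small.
Qed.

(** For two ramps the difference of the wrapping maps lifts to the reals; the last
clause lets the lift descend along a finer wrapping map. *)
Lemma wrap_shift (v w : ramp) : exists dl : circle L k -> R,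
  [/\ continuous dl, forall u, wrap w u = cadd (wrap v u) (wind (dl u)) &
    (forall x y, w x = w y -> v x = v y) ->
    forall a b, wrap w a = wrap w b -> dl a = dl b].
Proof.
have [dl cdl dlE] := shift_exists k v w; exists dl; split=> // [u|wv a b].
  have [i [x ->]] := circle_pt_surj u.
  by rewrite dlE !wrapE caddE -mulrDl; congr (wind (_ / _)); lra.
have [i [x ->]] := circle_pt_surj a; have [j [y ->]] := circle_pt_surj b.
rewrite !dlE => /(wrap_coarser_diff wv) E; congr (_ / _); lra.
Qed.

End fixed_degree.

Lemma wrap_cover (p k : nat) (pk0 : (0 < p * k)%N) (k0 : (0 < k)%N) (v : ramp)
    (a : circle L (p * k)) :
  cpow p%:Z (wrap pk0 v a) = wrap k0 v (circle_cover a).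
Proof.
have [i [x ->]] := circle_pt_surj a.
rewrite circle_coverE !wrapE cpowE -pmulrn natrM /=.
have [m ->] := modn_intE k i.
have k0' : k%:R != 0 :> R by rewrite pnatr_eq0 -lt0n.
have p0' : p%:R != 0 :> R by move: pk0; rewrite pnatr_eq0 -lt0n muln_gt0 => /andP[].
rewrite [in RHS]addrAC [in RHS]mulrDl mulfK// windDz; congr wind.
by rewrite invfM mulrCA !mulrA mulfK.
Qed.

End wrapping.

(** * Characteristics and divisibility *)

Section characteristics.
Context (R : realType).
Local Open Scope nat_scope.

Lemma degree_gt0 (p : nat -> nat) n : (forall n, 1 < p n) -> 0 < degree p n.
Proof. by move=> p1; elim: n => //= n IH; rewrite muln_gt0 IH (ltn_trans _ (p1 n)). Qed.

Lemma logn_degree (p : nat -> nat) l n : (forall n, 1 < p n) ->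
  logn l (degree p n) = \sum_(0 <= i < n) logn l (p i).
Proof.
move=> p1; elim: n => [|n IH]; first by rewrite big_nil logn1.
rewrite big_nat_recr//= lognM ?degree_gt0//; first by rewrite IH addnC.
exact: ltn_trans (p1 n).
Qed.

Lemma logn_le_characteristic (p : nat -> nat) l n : (forall n, 1 < p n) ->
  ((logn l (degree p n))%:R%:E <= characteristic R p l)%E.
Proof.
move=> p1; rewrite logn_degree// natr_sum -sumEFin.
by apply: nneseries_lim_ge => i _ _; rewrite lee_fin.
Qed.

(** The characteristic is the supremum of the multiplicities of the products. *)
Lemma characteristic_le (p : nat -> nat) l (x : \bar R) : (forall n, 1 < p n) ->
  (forall n, ((logn l (degree p n))%:R%:E <= x)%E) -> (characteristic R p l <= x)%E.
Proof.
move=> p1 px; apply: lime_le.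
  by apply: is_cvg_nneseries => i _ _; rewrite lee_fin.
by apply: nearW => n; rewrite sumEFin -natr_sum -logn_degree.
Qed.

Lemma characteristic_le_scaled (p q : nat -> nat) a l :
  (forall n, 1 < p n) -> (forall n, 1 < q n) -> 0 < a ->
  (forall n, exists m, degree q n %| a * degree p m) ->
  (characteristic R q l <= (logn l a)%:R%:E + characteristic R p l)%E.
Proof.
move=> p1 q1 a0 qp; apply: characteristic_le => // n; have [m nm] := qp n.
have := dvdn_leq_log l _ nm; rewrite muln_gt0 a0 degree_gt0// lognM ?degree_gt0//.
move=> /(_ isT) le_log; apply: (@le_trans _ _ ((logn l a)%:R%:E + (logn l (degree p m))%:R%:E)%E).
  by rewrite -EFinD lee_fin -natrD ler_nat.
by rewrite leeD2l// logn_le_characteristic.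
Qed.

(** Multiplicities change by at most those in [a] and [b], so they are infinite
together and agree at all primes outside the finite set of prime divisors
of [a * b]. *)
Lemma equivalent_of_dvd (p q : nat -> nat) a b :
  (forall n, 1 < p n) -> (forall n, 1 < q n) -> 0 < a -> 0 < b ->
  (forall n, exists m, degree q n %| a * degree p m) ->
  (forall n, exists m, degree p n %| b * degree q m) -> equivalent_seq R p q.
Proof.
move=> p1 q1 a0 b0 qp pq.
have le_qp l := characteristic_le_scaled l p1 q1 a0 qp.
have le_pq l := characteristic_le_scaled l q1 p1 b0 pq.
split=> [l _|].
  split=> E; [have := le_pq l|have := le_qp l]; rewrite E leye_eq => /eqP.
    by case: (characteristic R q l).
  by case: (characteristic R p l).
apply: (@sub_finite_set _ _ [set` primes (a * b)]); last exact: finite_seq.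
move=> l [lp neq]; rewrite /= mem_primes lp muln_gt0 a0 b0 /= Euclid_dvdM//.
apply: contrapT => /negP; rewrite negb_or => /andP[la lb]; apply: neq.
have l0 c : ~~ (l %| c) -> logn l c = 0 by move=> lc; rewrite lognE (negPf lc) !andbF.
apply/le_anti/andP; split.
  by have := le_pq l; rewrite l0// add0e.
by have := le_qp l; rewrite l0// add0e.
Qed.

Lemma logn_prod_pow (s : seq nat) (f : nat -> nat) l : uniq s -> all prime s ->
  prime l -> logn l (\prod_(r <- s) r ^ f r) = if l \in s then f l else 0.
Proof.
move=> + + lp; elim: s => [|r s IH] /=; first by rewrite big_nil logn1.
move=> /andP[rs us] /andP[rp ps].
have s0 : 0 < \prod_(t <- s) t ^ f t.
  rewrite big_seq; apply: prodn_cond_gt0 => t ts.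
  by rewrite expn_gt0 prime_gt0//; exact: (allP ps).
have r0 : 0 < r ^ f r by rewrite expn_gt0 prime_gt0.
rewrite big_cons (lognM _ r0 s0) (IH us ps) lognX logn_prime// inE.
have [->|lr] := eqVneq l r; last by rewrite muln0 add0n.
by rewrite (negPf rs) muln1 addn0.
Qed.

(** That the characteristic at [l] is the natural number [h], in a form that gives a
product attaining it. *)
Definition max_log (p : nat -> nat) l h :=
  (forall n, logn l (degree p n) <= h) /\ exists n, logn l (degree p n) = h.

Lemma max_log_exists (p : nat -> nat) l : (forall n, 1 < p n) ->
  characteristic R p l <> +oo%E -> exists h, max_log p l h.
Proof.
move=> p1 fin; have [B BP] : exists B, forall n, logn l (degree p n) <= B.
  have : (0 <= characteristic R p l)%E by apply: nneseries_ge0 => i _ _; rewrite lee_fin.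
  case E : (characteristic R p l) fin => [r| |]// _ r0.
  exists (Num.bound r) => n; have := logn_le_characteristic l n p1; rewrite E lee_fin => nr.
  rewrite -(ler_nat R); apply: le_trans nr _; apply: ltW; exact: archi_boundP.
have exP : exists h, `[< exists n, logn l (degree p n) = h >].
  by exists (logn l (degree p 0)); apply/asboolP; exists 0.
have ubP h : `[< exists n, logn l (degree p n) = h >] -> h <= B.
  by move=> /asboolP[n <-].
case: (ex_maxnP exP ubP) => h /asboolP hP hmax; exists h; split=> // n.
by apply: hmax; apply/asboolP; exists n.
Qed.

(** Divisibility is tested prime by prime, and only finitely many primes divide [a]. *)
Lemma dvd_from_logs (a : nat) (N : nat -> nat) : 0 < a -> (forall m, 0 < N m) ->
  (forall m m', m <= m' -> N m %| N m') ->
  (forall l, prime l -> exists m, logn l a <= logn l (N m)) ->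
  exists m, a %| N m.
Proof.
move=> a0 N0 Ndvd /=; set P := fun l m => logn l a <= logn l (N m).
move=> logs; have /choice[M MP] : forall l, exists m, prime l -> P l m.
  by move=> l; have [/logs[m]|] := boolP (prime l); [exists m|exists 0].
exists (\max_(l <- primes a) M l); apply/dvdn_partP => // l.
rewrite mem_primes => /and3P[lp _ la]; rewrite p_part pfactor_dvdn//.
apply: leq_trans (MP l lp) _; apply: dvdn_leq_log => //; apply: Ndvd.
by apply: (@leq_bigmax_seq _ _ xpredT M l) => //; rewrite mem_primes lp a0.
Qed.

Lemma degree_dvd (p : nat -> nat) n m : n <= m -> degree p n %| degree p m.
Proof.
elim: m => [|m IH]; first by rewrite leqn0 => /eqP ->.
by rewrite leq_eqVlt => /predU1P[->//|/IH nm] /=; exact: dvdn_mull.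
Qed.

Lemma prod_pow_gt0 (s : seq nat) (f : nat -> nat) : all prime s ->
  0 < \prod_(r <- s) r ^ f r.
Proof.
move=> ps; rewrite big_seq; apply: prodn_cond_gt0 => t ts.
by rewrite expn_gt0 prime_gt0//; exact: (allP ps).
Qed.

(** At a prime of [s] the scaled product of [p] reaches the multiplicity
[f l + g l], which bounds the multiplicity of the scaled product of [q]; at other
primes the scaling changes nothing and the characteristics agree. *)
Lemma scaled_dvd (p q : nat -> nat) (s : seq nat) (f g : nat -> nat) :
  (forall n, 1 < p n) -> (forall n, 1 < q n) -> uniq s -> all prime s ->
  (forall l, l \in s -> max_log p l (f l)) ->
  (forall l, l \in s -> max_log q l (g l)) ->
  (forall l, prime l -> l \notin s -> characteristic R p l = characteristic R q l) ->
  forall n, exists m, (\prod_(l <- s) l ^ f l) * degree q n %|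
                      (\prod_(l <- s) l ^ g l) * degree p m.
Proof.
move=> p1 q1 us ps pf qg good n; apply: dvd_from_logs => //.
- by rewrite muln_gt0 prod_pow_gt0 ?degree_gt0.
- by move=> m; rewrite muln_gt0 prod_pow_gt0 ?degree_gt0.
- by move=> m m' mm; rewrite dvdn_mul// degree_dvd.
move=> l lp; have [ls|ls] := boolP (l \in s).
  have [_ [m mE]] := pf l ls; have [qle _] := qg l ls; exists m.
  by rewrite !lognM ?prod_pow_gt0 ?degree_gt0// !logn_prod_pow// ls mE addnC leq_add2r.
have [m le_m] : exists m, logn l (degree q n) <= logn l (degree p m).
  apply: contrapT => nm.
  have lt_m m : logn l (degree p m) < logn l (degree q n).
    by rewrite ltnNge; apply/negP => ?; apply: nm; exists m.
  have : ((logn l (degree q n))%:R%:E <= ((logn l (degree q n)).-1)%:R%:E :> \bar R)%E.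
    apply: le_trans (logn_le_characteristic l n q1) _; rewrite -good//.
    apply: characteristic_le => // m; rewrite lee_fin ler_nat.
    by have := lt_m m; case: (logn l (degree q n)).
  rewrite lee_fin ler_nat; have := lt_m 0; case: (logn l (degree q n)) => // k _ /=.
  by rewrite ltnn.
by exists m; rewrite !lognM ?prod_pow_gt0 ?degree_gt0// !logn_prod_pow// (negPf ls) !add0n.
Qed.

(** The constants give each exceptional prime the same multiplicity in both scaled
sequences. *)
Lemma dvd_of_equivalent (p q : nat -> nat) :
  (forall n, 1 < p n) -> (forall n, 1 < q n) -> equivalent_seq R p q ->
  exists a b, [/\ 0 < a, 0 < b,
    forall n, exists m, a * degree q n %| b * degree p m &
    forall n, exists m, b * degree p n %| a * degree q m].
Proof.
move=> p1 q1 [infpq /finite_seqP[s sE]].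
pose bad l := prime l /\ characteristic R p l <> characteristic R q l.
have sP l : (l \in undup s) <-> bad l.
  by rewrite mem_undup; have : [set` s] l <-> bad l by rewrite -sE.
have fin l : bad l -> characteristic R p l <> +oo%E /\ characteristic R q l <> +oo%E.
  move=> [lp ne]; split=> inf; apply: ne.
    by rewrite inf; apply/esym/(infpq l lp).
  by rewrite inf; apply/(infpq l lp).
have /choice[f fP] : forall l, exists h, l \in undup s -> max_log p l h.
  move=> l; have [/sP/fin[pfin _]|_] := boolP (l \in undup s); last by exists 0.
  by have [h hP] := max_log_exists p1 pfin; exists h.
have /choice[g gP] : forall l, exists h, l \in undup s -> max_log q l h.
  move=> l; have [/sP/fin[_ qfin]|_] := boolP (l \in undup s); last by exists 0.
  by have [h hP] := max_log_exists q1 qfin; exists h.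
have us := undup_uniq s.
have ps : all prime (undup s) by apply/allP => l /sP[].
have good l : prime l -> l \notin undup s -> characteristic R p l = characteristic R q l.
  by move=> lp /negP nls; apply: contrapT => ne; apply: nls; apply/sP.
exists (\prod_(l <- undup s) l ^ f l), (\prod_(l <- undup s) l ^ g l); split.
- exact: prod_pow_gt0.
- exact: prod_pow_gt0.
- exact: scaled_dvd.
- by apply: scaled_dvd => // l lp ls; rewrite good.
Qed.

End characteristics.

(** * The circle expansion of a solenoid *)

(** The last two clauses say that homotopy classes of maps on [X] form the direct
limit of those of maps on the circle, along the power maps. *)
Record circle_expansion (R : realType) (X : topologicalType) (k : nat -> nat)
    (th : nat -> X -> circ R) : Prop := CircleExpansion {
  expansion_continuous : forall n, continuous (th n);
  expansion_bond : forall n m, (n <= m)%N ->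
    forall x, cpow (k m %/ k n)%N (th m x) = th n x;
  expansion_map : forall (W : shape_obj R) (f : X -> W), continuous f ->
    exists n (g : circ R -> W), continuous g /\ homotopic R f (g \o th n);
  expansion_homotopy : forall (W : shape_obj R) n (g0 g1 : circ R -> W),
    continuous g0 -> continuous g1 -> homotopic R (g0 \o th n) (g1 \o th n) ->
    exists2 m, (n <= m)%N &
      homotopic R (g0 \o cpow (k m %/ k n)%N) (g1 \o cpow (k m %/ k n)%N) }.

Section solenoid.
Context (R : realType) (d : Order.disp_t) (L : orderTopologicalType d) (p : nat -> nat).
Hypothesis hL : ordered_continuum L.
Hypothesis p1 : forall n, (1 < p n)%N.
Local Notation X := (solenoid L p).
Local Notation C := (circ R).
Local Notation ramp := (ramp R L).

Definition sproj (n : nat) (x : X) : circle L (degree p n) := val x n.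

Lemma sproj_continuous n : continuous (sproj n).
Proof.
pose T n : topologicalType := circle L (degree p n).
apply: (@continuous_comp_fun _ (prod_topology T) _ set_val (fun f : prod_topology T => f n)).
  exact: initial_continuous.
exact: (@proj_continuous _ T n).
Qed.

Lemma sproj_cover n x : circle_cover (sproj n.+1 x) = sproj n x.
Proof. by have := set_valP x; exact. Qed.

Lemma solenoid_pt (i : nat) (a : L) : exists x : X,
  forall n, sproj n x = circle_pt (Ordinal (ltn_pmod i (degree_gt0 n p1))) a.
Proof.
pose f : prod_topology (fun n => circle L (degree p n)) :=
  fun n => circle_pt (Ordinal (ltn_pmod i (degree_gt0 n p1))) a.
have fP n : circle_cover (f n.+1) = f n.
  rewrite /f circle_coverE; congr circle_pt; apply: val_inj => /=.
  by rewrite modn_dvdm// dvdn_mull.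
by exists (exist _ f (mem_set fP)).
Qed.

Lemma circle_hausdorff (k : nat) : (0 < k)%N -> hausdorff_space (circle L k).
Proof.
move=> k0; apply: (@separated_hausdorff _ C ramp (@wrap R d L k k0)).
- exact: circ_hausdorff.
- exact: wrap_continuous.
- exact: wrap_separates.
Qed.

(** A closed subset of a product of compact spaces, closed because the circles of arcs
are Hausdorff. *)
Lemma solenoid_compact : compact [set: X].
Proof.
have [_ cL _] := hL; apply: compact_set_type.
pose T n : topologicalType := circle L (degree p n).
have -> : [set x : prod_topology T | forall n, circle_cover (x n.+1) = x n] =
    [set x : prod_topology T | forall n, [set: T n] (x n)] `&`
    \bigcap_n [set x : prod_topology T | circle_cover (x n.+1) = x n].
  by apply/seteqP; split=> [x xP|x [_ xP] n]; [split=> // n _; exact: xP|exact: xP].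
apply: compact_closedI.
  by apply: (@tychonoff nat T (fun=> setT)) => n; exact: circle_compact.
apply: closed_bigI => n _; apply: closed_equalizer.
- exact/circle_hausdorff/degree_gt0.
- apply: (@continuous_comp_fun _ _ _ (fun x : prod_topology T => x n.+1) (@circle_cover _ _ _ _)).
    exact: (@proj_continuous _ T n.+1).
  exact: circle_cover_continuous.
- exact: (@proj_continuous _ T n).
Qed.

Definition swrap (n : nat) (v : ramp) (x : X) : C :=
  wrap (degree_gt0 n p1) v (sproj n x).

Lemma swrap_continuous n v : continuous (swrap n v).
Proof.
apply: (continuous_comp_fun (@sproj_continuous n)).
exact: (@wrap_continuous R d L _ (degree_gt0 n p1) v).
Qed.

Lemma swrap_bond n m v x : (n <= m)%N ->
  cpow (degree p m %/ degree p n)%N (swrap m v x) = swrap n v x.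
Proof.
elim: m => [|m IH] nm.
  by move: nm; rewrite leqn0 => /eqP ->; rewrite divnn degree_gt0// cpow1.
move: nm; rewrite leq_eqVlt => /predU1P[->|nm].
  by rewrite divnn degree_gt0// cpow1.
rewrite -(IH nm) /= -muln_divA ?degree_dvd// mulnC PoszM -cpowM; congr cpow.
rewrite /swrap -(sproj_cover m x) -(wrap_cover (degree_gt0 m.+1 p1)).
by [].
Qed.

(** Constant index sequences already give points over every point of the circle. *)
Lemma swrap_surj n v c : exists x, swrap n v x = c.
Proof.
have k0 := degree_gt0 n p1; have k0' : (degree p n)%:R != 0 :> R by rewrite pnatr_eq0 -lt0n.
have [s _ <-] := wind_surj c.
pose a := Num.floor ((degree p n)%:R * s).
have /andP[a0 a1] := floor_itv ((degree p n)%:R * s); rewrite -/a in a0 a1.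
have [|y vy] := ramp_surj hL v (_ : 0 <= (degree p n)%:R * s - a%:~R <= 1).
  by move: a1; rewrite intrD rmorph1 => a1; apply/andP; split; lra.
have aE := divz_eq a (degree p n).
have am : exists i : nat, (a %% degree p n)%Z = i.
  have := modz_ge0 a (_ : (degree p n)%:Z != 0); rewrite eqz_nat -lt0n => /(_ k0).
  by case: (_ %% _)%Z => // i _; exists i.
have [i iE] := am; have [x xP] := solenoid_pt i y; exists x.
rewrite /swrap xP wrapE vy /=.
have ik : (i < degree p n)%N.
  by have := ltz_pmod a (_ : (0 < (degree p n)%:Z)%R); rewrite iE ltz_nat; apply.
rewrite modn_small//.
have -> : i%:R = a%:~R - (a %/ degree p n)%Z%:~R * (degree p n)%:R :> R.
  by rewrite {1}aE iE intrD intrM -!pmulrn; lra.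
have -> : a%:~R - (a %/ degree p n)%Z%:~R * (degree p n)%:R + ((degree p n)%:R * s - a%:~R)
    = (s + (- (a %/ degree p n)%Z)%:~R) * (degree p n)%:R :> R.
  by rewrite intrN; lra.
by rewrite mulfK// windDz.
Qed.

Definition index : Type := (nat * ramp)%type.
Definition finer (i j : index) : Prop :=
  (i.1 <= j.1)%N /\ forall x y, j.2 x = j.2 y -> i.2 x = i.2 y.

Lemma finer_dir i j : exists k, finer i k /\ finer j k.
Proof.
case: i j => [n v] [m w]; have [z zE] := ramp_mean v w.
exists (maxn n m, z); rewrite /finer /= leq_maxl leq_maxr; split; split=> // x y;
  rewrite !zE; wlog xy : x y / (x <= y)%O => [hwlog E|].
- by case/orP: (le_total x y) => ?; [exact: hwlog|apply/esym/hwlog].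
- by move=> E; have := ramp_mono v xy; have := ramp_mono w xy; lra.
- by case/orP: (le_total x y) => ?; [exact: hwlog|apply/esym/hwlog].
- by move=> E; have := ramp_mono v xy; have := ramp_mono w xy; lra.
Qed.

Lemma finer_swrap i j : finer i j ->
  forall x y, swrap j.1 j.2 x = swrap j.1 j.2 y -> swrap i.1 i.2 x = swrap i.1 i.2 y.
Proof.
move=> [ij vw] x y /(congr1 (cpow (degree p j.1 %/ degree p i.1)%N)).
by rewrite !swrap_bond//; exact: wrap_coarser.
Qed.

Lemma swrap_separates x y :
  (forall i : index, swrap i.1 i.2 x = swrap i.1 i.2 y) -> x = y.
Proof.
move=> xy; apply: val_inj; apply: functional_extensionality_dep => n.
apply: (@wrap_separates R d L hL _ (degree_gt0 n p1) (sproj n x) (sproj n y)) => v.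
exact: (xy (n, v)).
Qed.

(** The factorization produced for a finer pair [(m, w)] goes through an auxiliary map
[T] with [T \o swrap m w = swrap n v0]. It is homotopic to the power map, as the
difference of [swrap n w] and [swrap n v0] lifts to a real function that is
constant on the fibers of [swrap m w]. *)
Theorem solenoid_expansion : exists th : nat -> X -> C, circle_expansion (degree p) th.
Proof.
have [v0] := ramp_exists R hL; exists (fun n => swrap n v0).
have cX := solenoid_compact; pose u (i : index) := swrap i.1 i.2.
have cu i : continuous (u i) by exact: swrap_continuous.
have finer_refl i : finer i i by split.
have finer_trans j i k : finer i j -> finer j k -> finer i k.
  move=> [ij vij] [jk vjk]; split; first exact: leq_trans jk.
  by move=> x y /vjk/vij.
have hom_wrap n v w : homotopic R (swrap n v) (swrap n w).
  have [dl [cdl dlE _]] := wrap_shift hL (degree_gt0 n p1) v w.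
  apply: shifted_homotopic; first exact: swrap_continuous.
  exists (dl \o sproj n) => [|x]; last exact: dlE.
  exact: (continuous_comp_fun (@sproj_continuous n) cdl).
split=> [n|n m nm x|W f cf|W n g0 g1 cg0 cg1 g01].
- exact: swrap_continuous.
- exact: swrap_bond.
- have [[n v] [g [cg fg]]] := map_factors (inhabits (0%N, v0)) cX cu
    (fun i => @swrap_surj i.1 i.2) finer_refl finer_trans finer_dir finer_swrap
    swrap_separates cf.
  exists n, g; split=> //; apply: (homotopic_trans fg).
  exact: (homotopic_comp (cu (n, v)) cg (hom_wrap n v v0) (@homotopic_refl R _ _ g cg)).
have [[m w] [T [[/= nm vw] cT TE hom]]] := homotopy_factors cX cu
    (fun i => @swrap_surj i.1 i.2) finer_refl finer_trans finer_dir finer_swrap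
    swrap_separates (i := (n, v0)) cg0 cg1 g01.
exists m => //.
have [dl [cdl dlE dlw]] := wrap_shift hL (degree_gt0 n p1) v0 w.
have [|D cD DE] := factor_through cX (@circ_hausdorff R) (cu (m, w)) (swrap_surj m w)
  (continuous_comp_fun (@sproj_continuous n) cdl).
  move=> x y /(congr1 (cpow (degree p m %/ degree p n)%N)).
  by rewrite /u /= !swrap_bond//; exact: dlw.
have homT : homotopic R T (cpow (degree p m %/ degree p n)%N).
  apply: shifted_homotopic => //; exists D => // c.
  have [x <-] := swrap_surj m w c.
  by rewrite swrap_bond// (DE x) (TE x); exact: dlE.
have gT (g : C -> W) : continuous g ->
    homotopic R (g \o T) (g \o cpow (degree p m %/ degree p n)%N).
  by move=> cg; apply: homotopic_comp => //; exact: homotopic_refl.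
apply: (homotopic_trans (homotopic_sym (gT g0 cg0))).
exact: (homotopic_trans hom (gT g1 cg1)).
Qed.

End solenoid.

(** * Transferring homotopy classes between expansions *)

Section classes.
Context (R : realType).

Definition map_class (X Y : topologicalType) (f : X -> Y) (cf : continuous f) : hclass R X Y :=
  hclass_of R (mkcts cf).

Lemma map_classP (X Y : topologicalType) (f g : X -> Y) (cf : continuous f) (cg : continuous g) :
  map_class cf = map_class cg <-> homotopic R f g.
Proof. exact: hclass_ofP. Qed.

Lemma map_class_surj (X Y : topologicalType) (a : hclass R X Y) :
  exists (f : X -> Y) (cf : continuous f), a = map_class cf.
Proof.
exists (repr a), (@cts_fun _ _ (repr a)); rewrite -[LHS]hclass_of_repr.
by apply/hclass_ofP/homotopic_refl; exact: cts_fun.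
Qed.

Lemma repr_hclass_of (X Y : topologicalType) (f : continuousType X Y) :
  homotopic R (repr (hclass_of R f)) f.
Proof. by apply/hclass_ofP; exact: hclass_of_repr. Qed.

Lemma repr_map_class (X Y : topologicalType) (f : X -> Y) (cf : continuous f) :
  homotopic R (repr (map_class cf)) f.
Proof. exact: repr_hclass_of. Qed.

Lemma map_class_comp (X Y Z : topologicalType) (g : Y -> Z) (f : X -> Y)
    (cg : continuous g) (cf : continuous f) (cgf : continuous (g \o f)) :
  hclass_comp (map_class cg) (map_class cf) = map_class cgf.
Proof.
rewrite /map_class hclass_compE; apply/hclass_ofP/homotopic_refl => x.
exact: cgf.
Qed.

Lemma homotopic_compr (X Y Z : topologicalType) (f : X -> Y) (g g' : Y -> Z) :
  continuous f -> continuous g' -> homotopic R g g' -> homotopic R (g \o f) (g' \o f).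
Proof. by move=> cf cg'; apply: homotopic_comp => //; exact: homotopic_refl. Qed.

Lemma homotopic_compl (X Y Z : topologicalType) (f f' : X -> Y) (g : Y -> Z) :
  continuous f -> continuous g -> homotopic R f f' -> homotopic R (g \o f) (g \o f').
Proof.
by move=> cf cg hf; apply: homotopic_comp => //; exact: homotopic_refl.
Qed.

End classes.

Lemma divn_mulr x y z : (y %| x)%N -> (x %| z)%N -> ((x %/ y) * (z %/ x))%N = (z %/ y)%N.
Proof.
move=> /dvdnP[a ->] /dvdnP[b ->].
have [->|y0] := posnP y; first by rewrite !muln0 div0n.
have [->|a0] := posnP a; first by rewrite mul0n muln0 !div0n.
by rewrite mulnK// mulnK ?muln_gt0 ?a0// mulnA mulnK// mulnC.
Qed.

Section transfer.
Context (R : realType).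
Local Notation C := (circ R).

Section one_way.
Context (X Y : topologicalType) (k l : nat -> nat).
Context (th : nat -> X -> C) (et : nat -> Y -> C).
Hypotheses (eX : circle_expansion k th) (eY : circle_expansion l et).
Hypothesis k_dvd : forall n m, (n <= m)%N -> (k n %| k m)%N.
Hypothesis l_dvd : forall n m, (n <= m)%N -> (l n %| l m)%N.
Hypothesis lk : forall n, exists m, (l n %| k m)%N.

(** The class of [g] at stage [n] of one system is matched with its image at a stage
[m] of the other one with [l n] dividing [k m]. For [k = l] this is the identity
of the direct limit. *)
Definition corresponds (W : shape_obj R) (f : Y -> W) (f' : X -> W) : Prop :=
  exists n m (g : C -> W), [/\ continuous g, (l n %| k m)%N,
    homotopic R f (g \o et n) & homotopic R f' (g \o (cpow (k m %/ l n)%N \o th m))].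

Let cth n := @expansion_continuous _ _ _ _ eX n.
Let cpw (m : int) := @cpow_continuous R m.

Lemma corresponds_total (W : shape_obj R) (f : Y -> W) : continuous f ->
  exists2 f' : X -> W, continuous f' & corresponds f f'.
Proof.
move=> cf; have [n [g [cg fg]]] := expansion_map eY cf.
have [m nm] := lk n; exists (g \o (cpow (k m %/ l n)%N \o th m)).
  exact: (continuous_comp_fun (continuous_comp_fun (@cth m) (@cpw _)) cg).
exists n, m, g; split=> //; apply: homotopic_refl.
exact: (continuous_comp_fun (continuous_comp_fun (@cth m) (@cpw _)) cg).
Qed.

Lemma expansion_raise n m M x : (n %| k m)%N -> (m <= M)%N ->
  cpow (k m %/ n)%N (th m x) = cpow (k M %/ n)%N (th M x).
Proof.
by move=> nm mM; rewrite -(expansion_bond eX mM) cpowM -PoszM divn_mulr// k_dvd.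
Qed.

(** Both representatives are raised to a common stage [n], where they agree after a
further stage [N]; a stage [M] of the other system beyond [N] then identifies the
two images. *)
Lemma corresponds_fun (W : shape_obj R) (f1 f2 : Y -> W) (f1' f2' : X -> W) :
  homotopic R f1 f2 -> corresponds f1 f1' -> corresponds f2 f2' -> homotopic R f1' f2'.
Proof.
move=> f12 [n1 [m1 [g1 [cg1 nm1 fg1 fg1']]]] [n2 [m2 [g2 [cg2 nm2 fg2 fg2']]]].
pose n := maxn n1 n2.
have [n1n n2n] : (n1 <= n)%N /\ (n2 <= n)%N by rewrite leq_maxl leq_maxr.
have raise n' (g : C -> W) : (n' <= n)%N ->
    g \o et n' = (g \o cpow (l n %/ l n')%N) \o et n.
  by move=> n'n; apply/funext => y /=; rewrite (expansion_bond eY n'n).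
have cgp (g : C -> W) (r : int) : continuous g -> continuous (g \o cpow r).
  by move=> cg; exact: continuous_comp_fun (@cpw r) cg.
have : homotopic R ((g1 \o cpow (l n %/ l n1)%N) \o et n) ((g2 \o cpow (l n %/ l n2)%N) \o et n).
  rewrite -(raise n1 g1 n1n) -(raise n2 g2 n2n); apply: homotopic_trans fg2.
  exact: homotopic_trans (homotopic_sym fg1) f12.
move=> /(expansion_homotopy eY (cgp _ _ cg1) (cgp _ _ cg2))[N nN hom].
have [M0 NM0] := lk N; pose M := maxn M0 (maxn m1 m2).
have NM : (l N %| k M)%N by apply: dvdn_trans NM0 (k_dvd _); exact: leq_maxl.
have [m1M m2M] : (m1 <= M)%N /\ (m2 <= M)%N by rewrite !leq_max !leqnn !orbT.
have raise' n' m (g : C -> W) : (n' <= n)%N -> (m <= M)%N -> (l n' %| k m)%N ->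
    g \o (cpow (k m %/ l n')%N \o th m) =
    ((g \o cpow (l n %/ l n')%N) \o cpow (l N %/ l n)%N) \o (cpow (k M %/ l N)%N \o th M).
  move=> n'n mM nm; apply/funext => x /=; rewrite !cpowM -!PoszM.
  rewrite (expansion_raise x nm mM) !divn_mulr//.
  - by apply: dvdn_trans (l_dvd n'n) (l_dvd nN).
  - exact: l_dvd.
  - exact: l_dvd.
apply: (homotopic_trans fg1'); apply/homotopic_sym/(homotopic_trans fg2').
rewrite (raise' n2 m2 g2 n2n m2M nm2) (raise' n1 m1 g1 n1n m1M nm1).
apply: homotopic_compr; last exact: homotopic_sym.
- exact: (continuous_comp_fun (@cth M) (@cpw _)).
- exact: cgp _ _ (cgp _ _ cg1).
Qed.

Lemma corresponds_homotopic (W : shape_obj R) (f1 f2 : Y -> W) (f1' f2' : X -> W) :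
  homotopic R f1 f2 -> homotopic R f1' f2' -> corresponds f1 f1' -> corresponds f2 f2'.
Proof.
move=> f12 f12' [n [m [g [cg nm fg fg']]]]; exists n, m, g; split=> //.
- exact: homotopic_trans (homotopic_sym f12) fg.
- exact: homotopic_trans (homotopic_sym f12') fg'.
Qed.

Lemma corresponds_comp (W W' : shape_obj R) (f : Y -> W) (f' : X -> W) (h : W -> W') :
  continuous f -> continuous f' -> continuous h ->
  corresponds f f' -> corresponds (h \o f) (h \o f').
Proof.
move=> cf cf' ch [n [m [g [cg nm fg fg']]]]; exists n, m, (h \o g); split=> //.
- exact: continuous_comp_fun cg ch.
- exact: (homotopic_compl cf ch fg).
- exact: (homotopic_compl cf' ch fg').
Qed.

Lemma corresponding_class (W : shape_obj R) (a : hclass R Y W) :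
  exists b : hclass R X W, corresponds (repr a) (repr b).
Proof.
have [f' cf' ff'] := corresponds_total (@cts_fun _ _ (repr a)).
exists (map_class R cf'); apply: corresponds_homotopic ff'.
  exact/homotopic_refl/cts_fun.
exact/homotopic_sym/repr_map_class.
Qed.

Definition transfer_fun (W : shape_obj R) (a : hclass R Y W) : hclass R X W :=
  projT1 (cid (corresponding_class a)).

Lemma transfer_funP (W : shape_obj R) (a : hclass R Y W) :
  corresponds (repr a) (repr (transfer_fun a)).
Proof. by rewrite /transfer_fun; case: cid. Qed.

Lemma transfer_fun_unique (W : shape_obj R) (a : hclass R Y W) (b : hclass R X W) :
  corresponds (repr a) (repr b) -> transfer_fun a = b.
Proof.
move=> ab; rewrite -[LHS]hclass_of_repr -[RHS]hclass_of_repr; apply/hclass_ofP.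
apply: corresponds_fun (transfer_funP a) ab.
exact/homotopic_refl/cts_fun.
Qed.

Lemma transfer_natural (W W' : shape_obj R) (g : hclass R W W') (a : hclass R Y W) :
  transfer_fun (hclass_comp g a) = hclass_comp g (transfer_fun a).
Proof.
apply: transfer_fun_unique.
have cga : continuous (repr g \o repr a) by apply: continuous_comp_fun; exact: cts_fun.
have cgb : continuous (repr g \o repr (transfer_fun a)).
  by apply: continuous_comp_fun; exact: cts_fun.
apply: corresponds_homotopic (corresponds_comp (@cts_fun _ _ (repr a)) _ _ (transfer_funP a)).
- by apply: homotopic_sym; exact: repr_hclass_of.
- by apply: homotopic_sym; exact: repr_hclass_of.
- exact: cts_fun.
- exact: cts_fun.
Qed.

Definition transfer : shape_map R X Y := ShapeMap transfer_natural.

End one_way.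

Section two_ways.
Context (X Y : topologicalType) (k l : nat -> nat).
Context (th : nat -> X -> C) (et : nat -> Y -> C).
Hypotheses (eX : circle_expansion k th) (eY : circle_expansion l et).
Hypothesis k_dvd : forall n m, (n <= m)%N -> (k n %| k m)%N.
Hypothesis l_dvd : forall n m, (n <= m)%N -> (l n %| l m)%N.
Hypothesis lk : forall n, exists m, (l n %| k m)%N.
Hypothesis kl : forall n, exists m, (k n %| l m)%N.

Lemma corresponds_sym (W : shape_obj R) (f : Y -> W) (f' : X -> W) :
  corresponds k l th et f f' -> corresponds l k et th f' f.
Proof.
move=> [n [m [g [cg nm fg fg']]]]; have [N0 mN0] := kl m; pose N := maxn N0 n.
have mN : (k m %| l N)%N by apply: dvdn_trans mN0 (l_dvd _); exact: leq_maxl.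
exists m, N, (g \o cpow (k m %/ l n)%N); split=> //.
  exact: (continuous_comp_fun (@cpow_continuous R _) cg).
suff -> : (g \o cpow (k m %/ l n)%N) \o (cpow (l N %/ k m)%N \o et N) = g \o et n by [].
apply/funext => y /=; rewrite cpowM -PoszM divn_mulr//.
by rewrite (expansion_bond eY)// leq_maxr.
Qed.

Lemma transfer_cancel (W : shape_obj R) (a : hclass R Y W) :
  transfer_fun eY eX kl (transfer_fun eX eY lk a) = a.
Proof.
apply: (transfer_fun_unique eY eX l_dvd k_dvd kl); apply: corresponds_sym.
exact: transfer_funP.
Qed.

End two_ways.

(** Interleaved direct systems have the same limit. *)
Lemma cofinal_same_shape (X Y : topologicalType) (k l : nat -> nat)
    (th : nat -> X -> C) (et : nat -> Y -> C) :
  circle_expansion k th -> circle_expansion l et ->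
  (forall n m, (n <= m)%N -> (k n %| k m)%N) ->
  (forall n m, (n <= m)%N -> (l n %| l m)%N) ->
  (forall n, exists m, (l n %| k m)%N) -> (forall n, exists m, (k n %| l m)%N) ->
  same_shape R X Y.
Proof.
move=> eX eY kd ld lk kl; exists (transfer eX eY kd ld lk).
exists (transfer eY eX ld kd kl); split=> W a /=.
  exact: transfer_cancel.
exact: transfer_cancel.
Qed.

(** Only the ratios of the numbers [k n] enter an expansion, so each of them may be
multiplied by a constant; this is how a finite change of the sequence is
absorbed. *)
Lemma circle_expansion_scale (X : topologicalType) (k : nat -> nat) (th : nat -> X -> C) a :
  (0 < a)%N -> circle_expansion k th -> circle_expansion (fun n => a * k n)%N th.
Proof.
move=> a0 [cth bond map hom]; split=> // [n m nm x|W n g0 g1 cg0 cg1 g01].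
  by rewrite divnMl// bond.
have [m nm homm] := hom W n g0 g1 cg0 cg1 g01.
by exists m => //; rewrite divnMl.
Qed.

End transfer.

(** * Shape equivalences preserve divisibility *)

Section invariance.
Context (R : realType).
Local Notation C := (circ R).

Lemma circ_dominated : exists (V : choiceType) (K : simplicial_complex V),
  Defs.dominated_by R C (realization R K).
Proof.
exists 'I_3, triangle, idfun, idfun.
by apply: homotopic_refl => x; exact: cvg_id.
Qed.

Definition circ_obj : shape_obj R := ShapeObj circ_dominated.

Let cpw (m : int) := @cpow_continuous R m.

Section one_space.
Context (X : topologicalType) (k : nat -> nat) (th : nat -> X -> C).
Hypothesis eX : circle_expansion k th.
Hypothesis k0 : forall n, (0 < k n)%N.
Hypothesis k_dvd : forall n m, (n <= m)%N -> (k n %| k m)%N.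

Lemma circ_map_expansion (f : X -> C) : continuous f ->
  exists (m : int) n, homotopic R f (cpow m \o th n).
Proof.
move=> cf; have [n [g [cg fg]]] := expansion_map (W := circ_obj) eX cf.
have [m gm] := circ_map_homotopic cg; exists m, n; apply: (homotopic_trans fg).
exact: (homotopic_compr (@expansion_continuous _ _ _ _ eX n) (@cpw m) gm).
Qed.

(** The class of [cpow m \o th n] behaves as the fraction [m / k n]. *)
Lemma expansion_degree (m1 m2 : int) n1 n2 :
  homotopic R (cpow m1 \o th n1) (cpow m2 \o th n2) ->
  m1 * (k n2)%:Z = m2 * (k n1)%:Z.
Proof.
move=> hom; pose n := maxn n1 n2.
have [n1n n2n] : (n1 <= n)%N /\ (n2 <= n)%N by rewrite leq_maxl leq_maxr.
have raise (m : int) n' : (n' <= n)%N ->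
    cpow m \o th n' = cpow (m * (k n %/ k n')%N) \o th n.
  by move=> n'n; apply/funext => x /=; rewrite -cpowM (expansion_bond eX).
move: hom; rewrite (raise m1 n1 n1n) (raise m2 n2 n2n) => hom.
have [N nN] := expansion_homotopy (W := circ_obj) eX (@cpw _) (@cpw _) hom.
have comp (m : int) : cpow m \o cpow (k N %/ k n)%N = cpow (m * (k N %/ k n)%N) :> (C -> C).
  by apply/funext => c /=; rewrite cpowM.
rewrite !comp => /cpow_homotopic_inj.
have r0 : (k N %/ k n)%N%:Z != 0.
  by rewrite eqz_nat -lt0n divn_gt0// dvdn_leq// k_dvd.
move=> /(mulIf r0) E.
have q1 : (k n)%:Z = (k n %/ k n1)%N%:Z * (k n1)%:Z by rewrite -PoszM divnK// k_dvd.
have q2 : (k n)%:Z = (k n %/ k n2)%N%:Z * (k n2)%:Z by rewrite -PoszM divnK// k_dvd.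
have kn0 : (k n)%:Z != 0 by rewrite eqz_nat -lt0n.
apply: (mulIf kn0); rewrite {1}q1 q2.
transitivity ((m1 * (k n %/ k n1)%N%:Z) * ((k n1)%:Z * (k n2)%:Z)); first by ring.
by rewrite E; ring.
Qed.

End one_space.

(** The class [e0] of [et 0] is the [l n]th power of the class of [et n]. Its image
is a fraction [m0 / k n0], which is therefore [l n] times another fraction. The
numerator [m0] is nonzero because [e0] is not fixed by the constant power map,
whereas the class with numerator 0 is. *)
Lemma shape_map_divides (X Y : topologicalType) (k l : nat -> nat)
    (th : nat -> X -> C) (et : nat -> Y -> C) (F : shape_map R X Y) :
  circle_expansion k th -> circle_expansion l et ->
  (forall n, (0 < k n)%N) -> (forall n, (0 < l n)%N) ->
  (forall n m, (n <= m)%N -> (k n %| k m)%N) ->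
  (forall n m, (n <= m)%N -> (l n %| l m)%N) -> l 0 = 1%N ->
  (forall W, injective (F W)) ->
  exists2 a, (0 < a)%N & forall n, exists m, (l n %| a * k m)%N.
Proof.
move=> eX eY k0 l0 k_dvd l_dvd l_start Finj.
have cet n := @expansion_continuous _ _ _ _ eY n.
have cth n := @expansion_continuous _ _ _ _ eX n.
pose act (Z : topologicalType) (m : int) (a : hclass R Z circ_obj) : hclass R Z circ_obj :=
  hclass_comp (map_class R (@cpw m) : hclass R circ_obj circ_obj) a.
have actE (Z : topologicalType) m (f : Z -> C) (cf : continuous f)
    (cmf : continuous (cpow m \o f)) : act Z m (map_class R cf) = map_class R cmf.
  exact: map_class_comp.
have Fequiv m a : F circ_obj (act Y m a) = act X m (F circ_obj a) by exact: shape_natural.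
have ccomp (Z : topologicalType) m (f : Z -> C) : continuous f -> continuous (cpow m \o f).
  by move=> cf; exact: continuous_comp_fun cf (@cpw m).
have expand (b : hclass R X circ_obj) : exists (m : int) n, b = map_class R (ccomp X m _ (cth n)).
  have [f [cf ->]] := map_class_surj b; have [m [n fm]] := circ_map_expansion eX cf.
  by exists m, n; apply/map_classP.
pose e0 := map_class R (cet 0) : hclass R Y circ_obj.
have [m0 [n0 Fe0]] := expand (F circ_obj e0).
have m0_neq0 : m0 != 0.
  apply/eqP => m00.
  have : act Y 0 e0 = e0.
    apply: Finj; rewrite Fequiv Fe0 m00 (actE X 0 _ _ (ccomp X 0 _ (ccomp X 0 _ (cth n0)))).
    apply/map_classP; rewrite (_ : cpow 0 \o (cpow 0 \o th n0) = cpow 0 \o th n0).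
      exact/homotopic_refl/ccomp.
    by apply/funext => x /=; rewrite cpowM mulr0.
  rewrite /e0 (actE Y 0 _ _ (ccomp Y 0 _ (cet 0))) => /map_classP.
  rewrite (_ : et 0 = cpow 1 \o et 0); last by apply/funext => y /=; rewrite cpow1.
  rewrite (_ : cpow 0 \o (cpow 1 \o et 0) = cpow 0 \o et 0); last first.
    by apply/funext => y /=; rewrite cpow1.
  move=> /(expansion_degree eY l0 l_dvd)/eqP.
  by rewrite mul0r mul1r eq_sym eqz_nat -leqn0 leqNgt l0.
exists `|m0|%N; first by rewrite absz_gt0.
move=> n; have e0E : e0 = act Y (l n)%:Z (map_class R (cet n)).
  rewrite (actE Y _ _ _ (ccomp Y _ _ (cet n))); apply/map_classP.
  rewrite (_ : cpow (l n) \o et n = et 0); first exact: homotopic_refl.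
  by apply/funext => y /=; rewrite -[RHS](expansion_bond eY (leq0n n)) l_start divn1.
have [m1 [n1 Fen]] := expand (F circ_obj (map_class R (cet n))).
move: Fe0; rewrite e0E Fequiv Fen (actE X _ _ _ (ccomp X _ _ (ccomp X _ _ (cth n1)))).
move=> /map_classP.
rewrite (_ : cpow (l n) \o (cpow m1 \o th n1) = cpow ((l n)%:Z * m1) \o th n1); last first.
  by apply/funext => x /=; rewrite cpowM.
move=> /(expansion_degree eX k0 k_dvd) E; exists n1.
have /(congr1 absz) := E; rewrite !abszM !absz_nat => {}E.
by rewrite -E -mulnA dvdn_mulr.
Qed.

End invariance.

Theorem corollary5p8 (R : realType) (d d' : Order.disp_t)
    (L : orderTopologicalType d) (L' : orderTopologicalType d')
    (p q : nat -> nat) :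
  ordered_continuum L -> ordered_continuum L' ->
  (forall n, (1 < p n)%N) -> (forall n, (1 < q n)%N) ->
  same_shape R (solenoid L p) (solenoid L' q) <-> equivalent_seq R p q.
Proof.
move=> hL hL' p1 q1.
have [th eX] := solenoid_expansion R hL p1.
have [et eY] := solenoid_expansion R hL' q1.
have p0 n := degree_gt0 n p1; have q0 n := degree_gt0 n q1.
have pd := @degree_dvd p; have qd := @degree_dvd q.
split=> [[F [G [FK GK]]]|/(dvd_of_equivalent p1 q1)[a [b [a0 b0 qp pq]]]].
  have [a a0 qp] := shape_map_divides eX eY p0 q0 pd qd erefl (fun W => can_inj (FK W)).
  have [b b0 pq] := shape_map_divides eY eX q0 p0 qd pd erefl (fun W => can_inj (GK W)).
  exact: equivalent_of_dvd a0 b0 qp pq.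
apply: (cofinal_same_shape (circle_expansion_scale b0 eX) (circle_expansion_scale a0 eY)) => //.
- by move=> n m nm; rewrite dvdn_mul// pd.
- by move=> n m nm; rewrite dvdn_mul// qd.
Qed.
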